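(* There exist absolute constants $c,c_1,c_2>0$ and, for all $m,k$, a positive number $c(m,k)$ depending only on $m$ and $k$, such that the following holds. Let $p$ be a quasipolynomial on $\mathbb{C}^n$ with $k$ exponents, degree $m$, exponential type $t(p)$ and diagram $D$, and let $\Omega\subset B:=Q_1^n=[0,1]^n$ satisfy $\omega_D(\Omega)>0$. Then $$\sup_{Q_1^n}|p|\le\left(\frac{c\,n\,\mu_n(B)}{\omega_D(\Omega)}\right)^{\ell}\cdot\sup_{\Omega}|p|,$$ where $\ell=c(m,k)+(m-1)\log\big(c_1\max\{1,t(p)\}\big)+c_2\,t(p)\operatorname{diam}(B)$.
   Context: $\mu_n$ is Lebesgue measure on $\mathbb{R}^n$. Quasipolynomials: let $f_1,\dots,f_k\in(\mathbb{C}^n)^*$ be pairwise different complex linear functionals, identified with scalar products $f_j\cdot z$, and write $f_j=a_j+ib_j$ with $a_j,b_j\in\mathbb{R}^n$. A quasipolynomial is a finite sum $p(z)=\sum_{j=1}^k p_j(z)e^{f_j\cdot z}$, where $p_j\in\mathbb{C}[z_1,\dots,z_n]$ has degree $d_j$. Its degree is $m=\sum_{j=1}^k(d_j+1)$, and its exponential type is $t(p)=\max_{1\le j\le k}\max_{z\in B_c(0,1)}|f_j\cdot z|$, where $B_c(0,1)$ is the complex Euclidean unit ball centered at $0$. Suprema of $|p|$ are over real points $x\in\mathbb{R}^n$. The maximal frequency is $\lambda=\max_{i,j}\|b_i-b_j\|$. The diagram $D$ of $p$ consists of $n$, $k$, the $d_j$, and $\lambda$. For bounded $A\subset\mathbb{R}^n$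 and $\varepsilon>0$, $M(\varepsilon,A)$ is the minimal number of translates of $[0,\varepsilon]^n$ covering $A$. Frequency bound: fix positive constants $C_0,\dots,C_{n-1}$, depending only on $D$, such that for every quasipolynomial $p$ with diagram $D$, every $\rho\ge0$ and every $0<\varepsilon\le1$, the sublevel set $A=\{x\in Q_1^n:\ |p(x)|\le\rho\}$ satisfies $$M(\varepsilon,A)\le\sum_{j=0}^{n-1}C_j\varepsilon^{-j}+\mu_n(A)\,\varepsilon^{-n}$$ (such constants exist). Put $M_D(\varepsilon)=\sum_{j=0}^{n-1}C_j\varepsilon^{-j}$ for $0<\varepsilon\le1$. The metric span of $\Omega\subset Q_1^n$ is $$\omega_D(\Omega)=\sup_{0<\varepsilon\le1}\varepsilon^n\,[M(\varepsilon,\Omega)-M_D(\varepsilon)].$$ *)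

(* Defs.v *)
From HB Require Import structures.
From mathcomp Require Import all_boot all_order all_algebra.
From mathcomp Require Import all_classical all_reals all_analysis.
From mathcomp Require Import complex.
(* Notations excluded: those of mpoly clash with those of the analysis
   library. *)
From mathcomp Require mpoly.
Import (canonicals, coercions) mpoly.

Set Implicit Arguments.
Unset Strict Implicit.
Unset Printing Implicit Defensive.

Import Order.TTheory GRing.Theory Num.Theory.
Import numFieldNormedType.Exports.

Local Open Scope classical_set_scope.
Local Open Scope ring_scope.

(* Euclidean; the library norm on row vectors is the sup norm. *)
Definition enorm (R : realType) (n : nat) (v : 'rV[R]_n) : R :=
  Num.sqrt (\sum_(i < n) v 0 i ^+ 2).

Definition diam (R : realType) (n : nat) (A : set 'rV[R]_n) : R :=
  sup [set enorm (u.1 - u.2) | u in A `*` A].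

Definition cmod (R : realType) (z : R[i]) : R := ComplexField.Normc.normc z.

Definition cexp (R : realType) (z : R[i]) : R[i] :=
  (expR (complex.Re z) * cos (complex.Im z)
   +i* (expR (complex.Re z) * sin (complex.Im z)))%C.

Definition cball (R : realType) (n : nat) : set 'rV[R[i]]_n :=
  [set z | Num.sqrt (\sum_(i < n) cmod (z 0 i) ^+ 2) <= 1].

(* No conjugation: the identification of f with a functional is C-linear. *)
Definition cdot (R : realType) (n : nat) (f z : 'rV[R[i]]_n) : R[i] :=
  \sum_(i < n) f 0 i * z 0 i.

Definition cube (R : realType) (n : nat) (s : R) : set 'rV[R]_n :=
  [set x | forall i, 0 <= x 0 i <= s].

Definition Q1 (R : realType) (n : nat) : set 'rV[R]_n := cube 1.

(* n-dimensional Lebesgue measure, as the n-fold product of the library's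
   lebesgue_measure: the successor case is the formula defining the product of
   lebesgue_measure and leb n, transported along R * R^n ~ R^(1 + n).  As for
   any product measure, the value is meaningful on measurable sets only; it is
   used on compact sets. *)
Fixpoint leb (R : realType) (n : nat) : set 'rV[R]_n -> \bar R :=
  match n return set 'rV[R]_n -> \bar R with
  | 0 => fun A => (\1_A (0 : 'rV[R]_0))%:E
  | n'.+1 => fun A =>
      (\int[@lebesgue_measure R]_x leb [set y : 'rV[R]_n' |
         A (row_mx x%:M y : 'rV[R]_(1 + n'))])%E
  end.

Definition covered (R : realType) (n : nat) (e : R) (A : set 'rV[R]_n)
    (N : nat) : Prop :=
  exists t : 'I_N -> 'rV[R]_n, A `<=` \bigcup_j (+%R (t j) @` cube e).

(* Junk value 0 when no finite cover exists, i.e. for unbounded A. *)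
Definition cover_num (R : realType) (n : nat) (e : R) (A : set 'rV[R]_n) : nat :=
  xget 0%N [set N | covered e A N /\ forall N', covered e A N' -> (N <= N')%N].

(* The p_j are nonzero, so that they have a degree. *)
Record quasipoly (R : realType) (n k : nat) := Quasipoly {
  qp_exp : 'I_k -> 'rV[R[i]]_n;
  qp_coef : 'I_k -> mpoly.mpoly n R[i];
  qp_exp_inj : injective qp_exp;
  qp_coef_neq0 : forall j, qp_coef j != 0 }.

(* The degrees d_j and the maximal frequency; n and k are parameters. *)
Definition diagram (R : realType) (n k : nat) : Type :=
  ({ffun 'I_k -> nat} * R)%type.

Section Quasipoly.
Variables (R : realType) (n k : nat).
Implicit Types p : quasipoly R n k.

Definition qp_eval p (z : 'rV[R[i]]_n) : R[i] :=
  \sum_(j < k) mpoly.meval (fun i => z 0 i) (qp_coef p j)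
               * cexp (cdot (qp_exp p j) z).

Definition qp_abs p (x : 'rV[R]_n) : R :=
  cmod (qp_eval p (map_mx (fun r : R => r%:C%C) x)).

Definition qp_sup p (A : set 'rV[R]_n) : R := sup [set qp_abs p x | x in A].

(* msize is the total degree plus one *)
Definition qp_deg p (j : 'I_k) : nat := (mpoly.msize (qp_coef p j)).-1.

Definition qp_degree p : nat := \sum_(j < k) (qp_deg p j).+1.

Definition qp_type p : R :=
  \big[Num.max/0]_(j < k) sup [set cmod (cdot (qp_exp p j) z) | z in @cball R n].

Definition qp_freq p : R :=
  \big[Num.max/0]_(i < k) \big[Num.max/0]_(j < k)
    enorm (map_mx (@complex.Im R) (qp_exp p i)
           - map_mx (@complex.Im R) (qp_exp p j)).

Definition qp_diagram p : diagram R n k := ([ffun j => qp_deg p j], qp_freq p).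

End Quasipoly.

Definition span_poly (R : realType) (n : nat) (C : 'I_n -> R) (e : R) : R :=
  \sum_(j < n) C j * e ^- j.

Definition frequency_bound (R : realType) (n k : nat) (D : diagram R n k)
    (C : 'I_n -> R) : Prop :=
  (forall j, 0 < C j) /\
  forall (p : quasipoly R n k) (rho e : R),
    qp_diagram p = D -> 0 <= rho -> 0 < e <= 1 ->
    let A := [set x | @Q1 R n x /\ qp_abs p x <= rho] in
    ((cover_num e A)%:R%:E <= (span_poly C e)%:E + leb A * (e ^- n)%:E)%E.

(* The metric span omega_D, for the constants C chosen for D. *)
Definition metric_span (R : realType) (n : nat) (C : 'I_n -> R)
    (Omega : set 'rV[R]_n) : R :=
  sup [set e ^+ n * ((cover_num e Omega)%:R - span_poly C e)
      | e in [set e : R | 0 < e <= 1]].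

(* Main.v *)
(** By definition of the metric span and of the frequency bound, the sublevel
    set A of p at height rho = sup_Omega |p| has measure at least
    omega = omega_D(Omega), so it suffices to prove a Remez inequality for A.

    Fix x in the cube.  The contractions of ratio r close to 1 towards x lose
    little measure: the preimage of A has measure at least
    |A| - n (1 - r).  Averaging over equally spaced ratios r in
    [1 - omega/2n, 1] gives a point y of the cube such that any prescribed
    number N of the points x + r (y - x), separated by about
    omega^2 / (n N), lie in A.

    On the segment from x to y, rescaled to length L = max(1, t diam), p is an
    exponential polynomial q with frequencies of modulus at most 1, killed by a
    differential operator (D - lam_1) ... (D - lam_m).  If the functions
    (D - lam_1) ... (D - lam_j) q, j < m, are bounded by S, then |q^(N)| is
    bounded by 2^N S, and S is bounded by K(m) sup |q|.  Hence the remainder of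
    Lagrange interpolation at N points of [0, L] is at most sup |q| / 2 as soon
    as N is at least a constant times L plus a constant depending on m, and
    sup |q| is at most twice the interpolation sum, that is
    2 (C n / omega^2)^N rho. *)

Require Import Defs.
From mathcomp Require Import all_boot all_order all_algebra.
From mathcomp Require Import all_classical all_reals all_analysis.
From mathcomp Require Import measurable_realfun complex ring lra zify.
From mathcomp Require mpoly.
Import (canonicals, coercions) mpoly.

Set Implicit Arguments.
Unset Strict Implicit.
Unset Printing Implicit Defensive.

Import Order.TTheory GRing.Theory Num.Theory.
Import numFieldNormedType.Exports.

Local Open Scope classical_set_scope.
Local Open Scope ring_scope.

(** * Divided differences *)

Section Interpolation.
Variable R : realType.
Implicit Types (G : nat -> R -> R) (a b x y : R).

(** A smooth function [G 0] together with all its derivatives; shifting the index differentiates. *)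
Definition derivative_tower G :=
  forall i x, is_derive x 1 (G i) (G i.+1 x).

Lemma derivative_tower_continuous G i :
  derivative_tower G -> continuous (G i).
Proof.
move=> dG x; apply/differentiable_continuous/derivable1_diffP.
by have [] := dG i x.
Qed.

(** Rolle between consecutive zeros gives one new zero per gap. Keeping the new zeros above [x] and
    below the last old zero lets the argument be repeated in the same interval. *)
Lemma Rolle_path (g dg : R -> R) x (s : seq R) :
  (forall y, is_derive y 1 g (dg y)) -> path <%R x s ->
  (forall y, y \in x :: s -> g y = 0) ->
  exists s', [/\ size s' = size s, path <%R x s',
    (forall y, y \in s' -> y <= last x s) & forall y, y \in s' -> dg y = 0].
Proof.
move=> dg'; elim: s x => [|y s IH] x /=; first by exists [::].
case/andP=> xy ys g0.
have [|s' [sz' p' le' z']] := IH y ys.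
  by move=> z zs; apply: g0; rewrite inE zs orbT.
have gcont : {within `[x, y], continuous g}.
  apply: continuous_subspaceT => z.
  apply/differentiable_continuous/derivable1_diffP.
  by have [] := dg' z.
have [||c cxy dc] := Rolle xy _ gcont.
- by move=> z _; by have [] := dg' z.
- by rewrite !g0 // !inE eqxx ?orbT.
move: cxy; rewrite in_itv /= => /andP[xc cy].
have yl : y <= last y s.
  have := mem_last y s; rewrite inE => /orP[/eqP -> //|h].
  by rewrite ltW //; move: (order_path_min lt_trans ys) => /allP /(_ _ h).
exists (c :: s'); split => /=.
- by rewrite sz'.
- rewrite xc /=; move: p'; case: (s') => //= z t /andP[yz ->].
  by rewrite (lt_trans cy yz).
- move=> z; rewrite inE => /orP[/eqP ->|/le' //].
  exact: le_trans (ltW cy) yl.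
- move=> z; rewrite inE => /orP[/eqP ->|/z' //].
  by have [_ <-] := dg' c; case: dc.
Qed.

(** Each use of Rolle passes to the shifted tower and loses one zero. *)
Lemma Rolle_iter N : forall G a b (s : seq R),
  derivative_tower G -> sorted <%R s -> size s = N.+1 ->
  (forall y, y \in s -> a <= y <= b /\ G 0%N y = 0) ->
  exists2 c, a <= c <= b & G N c = 0.
Proof.
elim: N => [|N IH] G a b [|x s] // dG sxs [sz] Gs.
  by have [xab Gx0] := Gs x (mem_head _ _); exists x.
have [s' [sz' p' le' z']] : exists s', [/\ size s' = size s, path <%R x s',
    (forall y, y \in s' -> y <= last x s)
    & forall y, y \in s' -> G 1%N y = 0].
  apply: (@Rolle_path (G 0%N) (G 1%N)) => //.
  by move=> y /Gs[].
have [| | | |c cab Gc] := IH (fun i => G i.+1) a b s'.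
- by move=> i y; exact: dG.
- exact: path_sorted p'.
- by rewrite sz'.
- move=> y ys'; split; last exact: z'.
  have [/andP[ax _] _] := Gs x (mem_head _ _).
  have [/andP[_ lb] _] := Gs _ (mem_last x s).
  rewrite (le_trans _ lb) ?le' // andbT (le_trans ax) //.
  by move: (order_path_min lt_trans p') => /allP /(_ _ ys') /ltW.
by exists c.
Qed.

Lemma lagrange_node_poly_monic N (y : 'I_N.+1 -> R) (j : 'I_N.+1) :
  let P := \prod_(l | l != j) ('X - (y l)%:P) in
  P \is monic /\ size P = N.+1.
Proof.
rewrite /= -big_filter; split; first exact: monic_prod_XsubC.
rewrite size_prod_XsubC; congr _.+1.
rewrite -sum1_size big_filter sum1_card.
by have := cardC1 j; rewrite card_ord.
Qed.

(* The right-hand side is N! times the divided difference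
   [G 0][y_0, ..., y_N]. *)
Lemma divided_difference_mean N G a b (y : 'I_N.+1 -> R) :
  derivative_tower G -> injective y -> (forall j, a <= y j <= b) ->
  exists2 c, a <= c <= b &
    G N c = N`!%:R * \sum_j G 0%N (y j) / \prod_(l | l != j) (y j - y l).
Proof.
move=> dG injy yab.
pose P j := \prod_(l | l != j) ('X - (y l)%:P).
pose w j := \prod_(l | l != j) (y j - y l).
have PE i j : (P j).[y i] = if i == j then w j else 0.
  rewrite /P horner_prod; case: eqP => [->|/eqP ij].
    by apply: eq_bigr => l _; rewrite !hornerE.
  by rewrite (bigD1 i) //= !hornerE subrr mul0r.
have w0 j : w j != 0.
  by apply/prodf_neq0 => l lj; rewrite subr_eq0 (inj_eq injy) eq_sym.
(* The Lagrange interpolation polynomial of [G 0]; its coefficient of degree N is the divided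
   difference. *)
pose Q := \sum_j (G 0%N (y j) / w j) *: P j.
have Qy i : Q.[y i] = G 0%N (y i).
  rewrite /Q horner_sum (bigD1 i) //= big1 => [|j ji].
    by rewrite addr0 hornerZ PE eqxx divfK.
  by rewrite hornerZ PE eq_sym (negPf ji) mulr0.
have sP j : size (P j) = N.+1 by have [] := lagrange_node_poly_monic y j.
have QN : Q`_N = \sum_j G 0%N (y j) / w j.
  rewrite /Q coef_sum; apply: eq_bigr => j _; rewrite coefZ.
  have [/monicP] := lagrange_node_poly_monic y j.
  by rewrite lead_coefE -/(P j) sP /= => -> _; rewrite mulr1.
have dQN : Q^`(N) = (N`!%:R * Q`_N)%:P.
  apply/polyP => i; rewrite coef_derivn coefC; case: i => [|i] /=.
    by rewrite addn0 ffactnn mulr_natl.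
  rewrite nth_default ?mul0rn //.
  apply: (leq_trans (size_sum _ _ _)); apply/bigmax_leqP => j _.
  by rewrite (leq_trans (size_scale_leq _ _)) // sP addnS ltnS leq_addr.
(* Rolle needs the N+1 zeros of [G 0 - Q] as an increasing list, whatever the order of the nodes. *)
pose s := sort <=%R (codom y).
have us : uniq s by rewrite sort_uniq /codom map_inj_uniq // enum_uniq.
have [| | | |c cab] :=
    @Rolle_iter N (fun i x => G i x - (Q^`(i)).[x]) a b s.
- move=> i x; rewrite derivnS.
  by apply: (@is_deriveB _ _ _ (G i) (horner Q^`(i)) x 1 (G i.+1 x)).
- by rewrite lt_sorted_uniq_le us /= sort_le_sorted.
- by rewrite size_sort size_codom card_ord.
- move=> z; rewrite mem_sort => /codomP[j ->]; split; first exact: yab.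
  by rewrite derivn0 Qy subrr.
move=> /eqP; rewrite subr_eq0 dQN hornerC QN => /eqP Gc.
by exists c.
Qed.

End Interpolation.

(** * The modulus of complex numbers *)

Section ComplexModulus.
Variable R : realType.
Implicit Types z w : R[i].

Lemma cmod_normE z : (cmod z)%:C%C = `|z|.
Proof. by rewrite normc_def; case: z. Qed.

Lemma cmod_ge0 z : 0 <= cmod z.
Proof. by case: z => a b; apply: sqrtr_ge0. Qed.

Lemma cmod0 : cmod (0 : R[i]) = 0.
Proof. exact: ComplexField.Normc.normc0. Qed.

Lemma cmodM z w : cmod (z * w) = cmod z * cmod w.
Proof. exact: ComplexField.Normc.normcM. Qed.

Lemma cmodD z w : cmod (z + w) <= cmod z + cmod w.
Proof. by rewrite -lecR rmorphD /= !cmod_normE ler_normD. Qed.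

Lemma cmodN z : cmod (- z) = cmod z.
Proof. by apply: complexI; rewrite /= !cmod_normE normrN. Qed.

Lemma cmod_eq0 z : cmod z = 0 -> z = 0.
Proof. exact: ComplexField.Normc.eq0_normc. Qed.

Lemma cmod_real (x : R) : cmod x%:C%C = `|x|.
Proof. by rewrite /cmod /= expr0n /= addr0 sqrtr_sqr. Qed.

Lemma cmodX z n : cmod (z ^+ n) = cmod z ^+ n.
Proof.
elim: n => [|n IH]; first by rewrite !expr0; exact: ComplexField.Normc.normc1.
by rewrite !exprS cmodM IH.
Qed.

Lemma cmod_sum (I : Type) (r : seq I) (P : pred I) (f : I -> R[i]) :
  cmod (\sum_(i <- r | P i) f i) <= \sum_(i <- r | P i) cmod (f i).
Proof.
elim/big_ind2: _ => // [|x1 x2 y1 y2 h1 h2]; first by rewrite cmod0.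
exact: le_trans (cmodD _ _) (lerD h1 h2).
Qed.

Lemma cmod_prod (I : Type) (r : seq I) (P : pred I) (f : I -> R[i]) :
  cmod (\prod_(i <- r | P i) f i) = \prod_(i <- r | P i) cmod (f i).
Proof.
by apply: (big_morph _ cmodM); exact: ComplexField.Normc.normc1.
Qed.

Lemma Re_le_cmod z : `|complex.Re z| <= cmod z.
Proof. by rewrite -lecR cmod_normE normc_ge_Re. Qed.

(** For nonzero z, u is the conjugate of z divided by the modulus. A bound on a complex function at
    one point thus follows from a bound on a real function, to which Rolle and the mean value
    theorem apply. *)
Lemma cmod_rotation z :
  exists2 u : R[i], cmod u <= 1 & complex.Re (u * z) = cmod z.
Proof.
have [->|z0] := eqVneq z 0.
  by exists 0; rewrite ?mul0r cmod0.
have cz0 : cmod z != 0 by apply: contra_neq z0 => /cmod_eq0.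
exists (z^*%C * ((cmod z)^-1)%:C%C).
  rewrite cmodM cmod_real normfV ger0_norm ?cmod_ge0 //.
  rewrite (_ : cmod z^*%C = cmod z) ?divff //.
  by case: (z) => a b; rewrite /cmod /= sqrrN.
suff -> : z^*%C * ((cmod z)^-1)%:C%C * z = (cmod z)%:C%C by [].
rewrite mulrAC (mulrC _ z) -sqr_normc -cmod_normE -rmorphXn -rmorphM /=.
by rewrite expr2 mulfK.
Qed.

End ComplexModulus.

(** * Derivatives of solutions of a linear differential equation *)

Section ExponentialTower.
Variable R : realType.

Definition complex_tower (F : nat -> R -> R[i]) :=
  forall (i : nat) (x : R), is_derive x 1 (fun y => complex.Re (F i y))
                            (complex.Re (F i.+1 x)) /\
              is_derive x 1 (fun y => complex.Im (F i y))
                            (complex.Im (F i.+1 x)).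

Lemma complex_tower_Re (u : R[i]) F : complex_tower F ->
  derivative_tower (fun i x => complex.Re (u * F i x)).
Proof.
move=> dF i x; have [dR dI] := dF i x; case: u => a b.
have E j : (fun y => complex.Re ((a +i* b)%C * F j y)) =
    (fun y => a * complex.Re (F j y) - b * complex.Im (F j y)).
  by apply/funext => y; case: (F j y).
rewrite E (_ : complex.Re _ = a * complex.Re (F i.+1 x)
   - b * complex.Im (F i.+1 x)); last by case: (F i.+1 x).
apply: is_deriveB.
Qed.

(* [F j i] is the i-th derivative of (D - lam_0) ... (D - lam_{j-1}) q, where
   q = [F 0 0]; the product of all m factors annihilates q. *)
Definition exp_tower m (lam : nat -> R[i]) (F : nat -> nat -> R -> R[i]) :=
  [/\ complex_tower (F 0%N),
      forall j i x, F j.+1 i x = F j i.+1 x - lam j * F j i x,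
      forall i x, F m i x = 0 & forall j, cmod (lam j) <= 1].

Variables (m : nat) (lam : nat -> R[i]) (F : nat -> nat -> R -> R[i]).
Hypothesis tF : exp_tower m lam F.

(** [F j i.+1] equals [F j.+1 i + lam j * F j i] with [lam j] of modulus at most 1, so each
    differentiation at most doubles the bound. *)
Lemma exp_tower_growth x S : 0 <= S ->
  (forall j, (j < m)%N -> cmod (F j 0%N x) <= S) ->
  forall N, cmod (F 0%N N x) <= 2 ^+ N * S.
Proof.
move=> S0 FS; case: tF => _ Fj Fm lam1.
(* Induction on the number [d] of factors still to be applied; with none left the function
   vanishes. *)
suff H d : (d <= m)%N -> forall N, cmod (F (m - d)%N N x) <= 2 ^+ N * S.
  by move=> N; have := H m (leqnn m) N; rewrite subnn.
elim: d => [|d IHd] dm N.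
  by rewrite subn0 Fm cmod0 mulr_ge0 // exprn_ge0.
have E : ((m - d.+1).+1 = m - d)%N by rewrite subnSK.
elim: N => [|N IHN].
  by rewrite expr0 mul1r FS // ltn_subrL (leq_trans _ dm).
have -> : F (m - d.+1)%N N.+1 x =
    F (m - d)%N N x + lam (m - d.+1)%N * F (m - d.+1)%N N x.
  by rewrite -E Fj subrK.
apply: (le_trans (cmodD _ _)); rewrite cmodM exprS -mulrA mulr_natl mulr2n.
apply: lerD; first by rewrite IHd // ltnW.
by rewrite -[leRHS]mul1r ler_pM ?cmod_ge0.
Qed.

(** Each factor D - lam uses one more order of differentiation and at most doubles the bound. *)
Lemma exp_tower_shift_le x A N :
  (forall i, (i <= N)%N -> cmod (F 0%N i x) <= A) ->
  forall j i, (i + j <= N)%N -> cmod (F j i x) <= 2 ^+ j * A.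
Proof.
case: tF => _ Fj _ lam1 FA; elim=> [|j IH] i ij.
  by rewrite expr0 mul1r FA // -(addn0 i).
rewrite Fj (le_trans (cmodD _ _)) // cmodN cmodM exprS -mulrA mulr_natl mulr2n.
apply: lerD; first by rewrite IH // addSnnS.
rewrite -[leRHS]mul1r ler_pM ?cmod_ge0 // IH //.
by rewrite (leq_trans _ ij) // leq_add2l.
Qed.

Variables (L M S : R).
Hypothesis FM : forall x, 0 <= x <= L -> cmod (F 0%N 0%N x) <= M.
Hypothesis FS : forall j x, (j < m)%N -> 0 <= x <= L -> cmod (F j 0%N x) <= S.

(** On a window of length h around x, the divided difference at i+1 equally spaced nodes bounds the
    i-th derivative at some point c by a multiple of M. The mean value theorem carries the bound
    from c to x, at the cost of h times a bound for the next derivative. *)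
Lemma exp_tower_low_derivative h i x : 0 < h <= 1 -> 1 <= L -> (i < m)%N ->
  0 <= x <= L ->
  cmod (F 0%N i x) <= m`!%:R * m%:R * (m%:R / h) ^+ m * M + h * (2 ^+ m * S).
Proof.
case: (tF) => dF _ _ _ /andP[h0 h1] L1 im /andP[x0 xL].
have S0 : 0 <= S.
  apply: le_trans (cmod_ge0 (F 0%N 0%N x)) (FS _ _); last by rewrite x0.
  exact: leq_ltn_trans im.
have M0 : 0 <= M by apply: le_trans (cmod_ge0 _) (FM (x := x) _); rewrite x0.
have m0 : 0 < m%:R :> R by rewrite ltr0n (leq_trans _ im).
have m1 : 1 <= m%:R :> R by rewrite ler1n (leq_trans _ im).
have [u u1 <-] := cmod_rotation (F 0%N i x).
pose G i x := complex.Re (u * F 0%N i x).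
have dG : derivative_tower G by apply: complex_tower_Re.
have GF k y : `|G k y| <= cmod (F 0%N k y).
  by rewrite (le_trans (Re_le_cmod _)) // cmodM ler_piMl ?cmod_ge0.
(* The window [[a, a + h]] contains x and lies in [0, L], even when x is close to L. *)
pose a := Num.min x (L - h).
have a0 : 0 <= a by rewrite le_min x0 subr_ge0 (le_trans h1).
have ax : a <= x by rewrite ge_min lexx.
have xa : x <= a + h.
  by rewrite /a minEle; case: ifP => _; [rewrite lerDl ltW|rewrite subrK].
have aL : a + h <= L by rewrite -lerBrDr ge_min lexx orbT.
(* The spacing h / m serves for all i < m; since w <= 1, the i factors of each denominator have
   product at least w^m. *)
pose w := h / m%:R.
have w0 : 0 < w by rewrite divr_gt0.
have w1 : w <= 1.
  by rewrite ler_pdivrMr // mul1r (le_trans h1).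
pose y (l : 'I_i.+1) := a + w * l%:R.
have yB l : a <= y l <= a + h.
  rewrite lerDl mulr_ge0 ?(ltW w0) // lerD2l /w mulrAC ler_pdivrMr //=.
  by rewrite ler_pM2l // ler_nat (leq_trans _ im) // ltnW // ltnS -ltnS.
have dy l l' : l != l' -> w <= `|y l - y l'|.
  move=> ll'; rewrite /y opprD addrACA subrr add0r -mulrBr normrM.
  rewrite (gtr0_norm w0) ler_pMr //.
  wlog lt_ll : l l' ll' / (l < l')%N => [H|].
    have /orP[/H->//|lt] : ((l < l') || (l' < l))%N by rewrite -neq_ltn.
    by rewrite distrC H // eq_sym.
  rewrite distrC -natrB 1?ltnW // ger0_norm // ler1n subn_gt0 //.
have injy : injective y.
  move=> l l' e; apply/eqP; apply: contraT => /dy; rewrite e subrr normr0.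
  by rewrite leNgt w0.
have [c cB Gc] := divided_difference_mean dG injy yB.
have GcB : `|G i c| <= m`!%:R * m%:R * (m%:R / h) ^+ m * M.
  rewrite Gc normrM normr_nat -!mulrA.
  apply: ler_pM => //; first by rewrite ler_nat leq_fact // ltnW.
  apply: (le_trans (ler_norm_sum _ _ _)).
  apply: (@le_trans _ _ (\sum_(l < i.+1) (m%:R / h) ^+ m * M)); last first.
    rewrite sumr_const card_ord -[leLHS]mulr_natl ler_wpM2r ?ler_nat //.
    by rewrite mulr_ge0 // exprn_ge0 // divr_ge0 // ltW.
  apply: ler_sum => l _; rewrite normrM normfV normr_prod mulrC.
  apply: ler_pM; rewrite ?invr_ge0 ?prodr_ge0 //; last first.
    rewrite (le_trans (GF _ _)) // FM //.
    by case/andP: (yB l) => ? ?; rewrite (le_trans a0) //= (le_trans _ aL).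
  rewrite -[_ / h]invf_div -/w exprVn lef_pV2 ?posrE ?exprn_gt0 //; last first.
    by apply: prodr_gt0 => l' ll'; rewrite (lt_le_trans w0) // dy // eq_sym.
  apply: (@le_trans _ _ (\prod_(l' < i.+1 | l' != l) w)); last first.
    by apply: ler_prod => l' ll'; rewrite (ltW w0) dy // eq_sym.
  rewrite prodr_const (_ : #|_| = i); last first.
    by have := cardC1 l; rewrite card_ord.
  by rewrite ler_wiXn2l // ?(ltW w0) // ltnW.
(* The next derivative has order at most m, so [exp_tower_growth] bounds it by [2 ^+ m * S]. *)
have step p q : p <= q -> a <= p -> q <= a + h ->
    `|G i q - G i p| <= h * (2 ^+ m * S).
  move=> pq ap qb.
  have [||z zpq ->] := @MVT_segment _ (G i) (G i.+1) p q pq.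
  - by move=> z _; exact: dG.
  - by apply: continuous_subspaceT; exact: derivative_tower_continuous.
  move: zpq; rewrite in_itv /= => /andP[pz zq].
  rewrite normrM mulrC ler_pM //.
    rewrite ger0_norm ?subr_ge0 // lerBlDr (le_trans qb) // addrC lerD2l //.
  rewrite (le_trans (GF _ _)) // (le_trans (exp_tower_growth S0 _ _)) //.
    move=> j jm; apply: FS => //.
    by rewrite (le_trans a0 (le_trans ap pz)) (le_trans zq) // (le_trans qb).
  by rewrite ler_wpM2r // ler_weXn2l // ?ler1n.
rewrite -/(G i x); apply: (le_trans (ler_norm _)).
rewrite -[G i x](subrK (G i c)) addrC.
apply: (le_trans (ler_normD _ _)); apply: lerD => //.
have [xc|cx] := leP x c; last by apply: step => //; [exact: ltW|case/andP: cB].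
by rewrite distrC; apply: step => //; case/andP: cB.
Qed.

End ExponentialTower.

(** * A Bernstein inequality for exponential towers *)

Section Bernstein.
Variable R : realType.

(** This is 2 * 2^m * K, where K is the coefficient of M in [exp_tower_low_derivative] for h = 1 /
    (2 * 4^m); the first factor 2 comes from absorbing half of the supremum. *)
Definition bernstein_const (m : nat) : R :=
  2 ^+ m.+1 * (m`!%:R * m%:R * (m%:R * (2 * 4 ^+ m)) ^+ m).

Lemma bernstein_const_ge0 m : 0 <= bernstein_const m.
Proof. by rewrite /bernstein_const !(mulr_ge0, exprn_ge0). Qed.

(** Only finiteness matters: it makes the suprema below finite, so that half of them can be
    absorbed. *)
Definition tower_bounded m (F : nat -> nat -> R -> R[i]) L :=
  exists B, forall j x, (j < m)%N -> 0 <= x <= L -> cmod (F j 0%N x) <= B.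

(** The common supremum S of the functions satisfies S <= 2^m (K M + h 2^m S), and a small h makes
    the last term S / 2. *)
Lemma exp_tower_bernstein m lam F L M : exp_tower m lam F ->
  tower_bounded m F L -> 1 <= L ->
  (forall x, 0 <= x <= L -> cmod (F 0%N 0%N x) <= M) ->
  forall j x, (j < m)%N -> 0 <= x <= L ->
  cmod (F j 0%N x) <= bernstein_const m * M.
Proof.
move=> tF [B FB] L1 FM j0 x0 jm0 xL0.
pose E := [set r | exists j x, [/\ (j < m)%N, 0 <= x <= L
                                 & r = cmod (F j 0%N x)]].
have supE : has_sup E.
  split; first by exists (cmod (F j0 0%N x0)), j0, x0.
  by exists B => _ [j [x [jm xL ->]]]; exact: FB.
pose S := sup E.
have FS j x : (j < m)%N -> 0 <= x <= L -> cmod (F j 0%N x) <= S.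
  by move=> jm xL; apply: ub_le_sup; [case: supE|exists j, x].
have S0 : 0 <= S by apply: le_trans (FS _ _ jm0 xL0); exact: cmod_ge0.
suff SM : S <= bernstein_const m * M by apply: le_trans SM; exact: FS.
(* Chosen so that [2 ^+ m * (h * (2 ^+ m * S))] is half of [S]. *)
pose h : R := (2 * 4 ^+ m)^-1.
have p4 : 1 <= 4 ^+ m :> R by rewrite exprn_ege1 // ler1n.
have h0 : 0 < h by rewrite invr_gt0 mulr_gt0 // (lt_le_trans _ p4).
have h1 : h <= 1 by rewrite invf_le1 ?(lt_le_trans _ p4) //; lra.
pose K : R := m`!%:R * m%:R * (m%:R / h) ^+ m.
have low i x : (i < m)%N -> 0 <= x <= L ->
    cmod (F 0%N i x) <= K * M + h * (2 ^+ m * S).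
  move=> im xL.
  by apply: (exp_tower_low_derivative tF FM FS _ L1 im xL); rewrite h0.
have SK : S <= 2 ^+ m * (K * M + h * (2 ^+ m * S)).
  apply: ge_sup => [|_ [j [x [jm xL ->]]]]; first by case: supE.
  (* For j < m only derivatives of order at most m - 1 enter, and [low] bounds all of these. *)
  apply: (le_trans (exp_tower_shift_le tF (N := m.-1)
      (A := K * M + h * (2 ^+ m * S)) _ (j := j) (i := 0) _)).
  - by move=> i im; apply: low => //; rewrite -(ltn_predK jm).
  - by rewrite add0n -ltnS (ltn_predK jm).
  rewrite ler_wpM2r //; last by rewrite ler_weXn2l ?ler1n // ltnW.
  apply: le_trans (low 0%N x _ xL); first exact: cmod_ge0.
  exact: leq_ltn_trans jm.
have E1 : 2 ^+ m * (h * (2 ^+ m * S)) = S / 2.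
  have -> : h = (2 * (2 ^+ m * 2 ^+ m))^-1.
    by rewrite -exprMn /h; congr (2 * _ ^+ _)^-1; ring.
  by field; apply: expf_neq0; rewrite pnatr_eq0.
have E2 : bernstein_const m = 2 * (2 ^+ m * K).
  by rewrite /bernstein_const /K /h invrK exprS -mulrA.
move: SK; rewrite mulrDr E1 E2 -!mulrA.
move: (2 ^+ m * (K * M)) => X; lra.
Qed.

End Bernstein.

(** * Factorial estimates *)

Section Remez.
Variable R : realType.

(** The factors with l < j give j!, those with l > j give (n - j)!. *)
Lemma prod_dist_fact n (j : 'I_n.+1) :
  \prod_(l < n.+1 | l != j) `|j%:R - l%:R : R| = (j`! * (n - j)`!)%:R.
Proof.
have -> : \prod_(l < n.+1 | l != j) `|j%:R - l%:R : R| =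
    \prod_(0 <= l < n.+1 | l != j :> nat) `|j%:R - l%:R : R|.
  by rewrite big_mkord.
have jn : (j <= n)%N by rewrite -ltnS.
rewrite (big_cat_nat (n := j)) //=; last by rewrite ltnW.
rewrite [X in _ * X]big_ltn_cond // eqxx /= natrM; congr (_ * _).
  rewrite fact_prod big_add1 /= big_nat_rev /= natr_prod.
  rewrite big_nat_cond [RHS]big_nat_cond; apply: eq_big => l.
    rewrite andbT; case: (ltnP l j) => //= lj; rewrite neq_ltn.
    by rewrite add0n ltn_subrL /= (leq_ltn_trans _ lj).
  rewrite add0n => /andP[/andP[_ lj] _].
  by rewrite natrB // opprB addrC subrK ger0_norm.
rewrite fact_prod natr_prod -{1}[j.+1]add0n big_addn.
rewrite [RHS]big_add1 /= subSS.
rewrite big_nat_cond [RHS]big_nat_cond; apply: eq_big => l.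
  by rewrite andbT addnS gtn_eqF ?andbT // ltnS leq_addl.
move=> _; rewrite distrC -natrB; last by rewrite addnS ltnW // ltnS leq_addl.
by rewrite addnS -addSn addnK ger0_norm.

Qed.

(** After multiplication by n! the terms are the binomial coefficients. *)
Lemma sum_inv_fact n :
  \sum_(j < n.+1) ((j`! * (n - j)`!)%:R : R)^-1 = 2 ^+ n / n`!%:R.
Proof.
have -> : 2 ^+ n = \sum_(j < n.+1) 'C(n, j)%:R :> R.
  rewrite -natrX -[2%N]/(1 + 1)%N expnDn natr_sum.
  by apply: eq_bigr => j _; rewrite !exp1n !muln1.
rewrite mulr_suml; apply: eq_bigr => j _.
rewrite -(@bin_fact n j) -1?ltnS // [in RHS]natrM invfM mulrA mulfV ?mul1r //.
by rewrite pnatr_eq0 -lt0n bin_gt0 -ltnS.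
Qed.

(** The term of index n+1 in the exponential series at n+1 is at most the whole sum. *)
Lemma fact_ge_exp n : (n.+1%:R / expR 1) ^+ n.+1 <= n.+1`!%:R :> R.
Proof.
have n0 : 0 < n.+1`!%:R :> R by rewrite ltr0n fact_gt0.
have := @expR_ge1Dxn R n.+1%:R n (ler0n _ _).
rewrite -[X in expR X]mulr1 expRM_natl.
rewrite exprMn exprVn ler_pdivrMr ?exprn_gt0 ?expR_gt0 // => H.
rewrite mulrC -ler_pdivrMr //; apply: le_trans H.
by rewrite lerDr.
Qed.

End Remez.

(** * Lagrange interpolation and the Remez inequality for towers *)

Section RemezTower.
Variable R : realType.

(** The divided difference at x and the nodes is a value of [G n.+1] over (n+1)!; solving for
    [G 0 x] gives Lagrange's formula with remainder. The separation bounds the denominators below by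
    w^n j! (n - j)!, whose inverses sum to 2^n / (w^n n!). *)
Lemma interpolation_bound (G : nat -> R -> R) n (y : 'I_n.+1 -> R)
    (L w rho D x : R) :
  derivative_tower G -> 0 < w -> 0 <= D ->
  (forall i j : 'I_n.+1, w * `|i%:R - j%:R| <= `|y i - y j|) ->
  (forall j, 0 <= y j <= L) -> (forall j, `|G 0%N (y j)| <= rho) ->
  (forall c, 0 <= c <= L -> `|G n.+1 c| <= D) -> 0 <= x <= L ->
  (forall j, y j != x) ->
  `|G 0%N x| <= L ^+ n.+1 / n.+1`!%:R * D + (2 * L / w) ^+ n / n`!%:R * rho.
Proof.
move=> dG w0 D0 sep yL yrho GD xL yx.
have L0 : 0 <= L by case/andP: xL => /le_trans; apply.
have rho0 : 0 <= rho by apply: le_trans (yrho ord0).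
have neq_dist (i j : 'I_n.+1) : i != j -> 0 < `|i%:R - j%:R : R|.
  by move=> ij; rewrite normr_gt0 subr_eq0 eqr_nat.
have injy i j : i != j -> y i != y j.
  move=> ij; rewrite -subr_eq0 -normr_gt0 (lt_le_trans _ (sep i j)) //.
  by rewrite mulr_gt0 // neq_dist.
have dist_le a b : 0 <= a <= L -> 0 <= b <= L -> `|a - b| <= L.
  by move=> /andP[? ?] /andP[? ?]; rewrite ler_norml; apply/andP; split; lra.
(* The point x becomes node 0, and the given nodes follow. *)
pose z (j : 'I_n.+2) := oapp y x (unlift ord0 j).
have z0 : z ord0 = x by rewrite /z unlift_none.
have zS j : z (lift ord0 j) = y j by rewrite /z liftK.
have injz : injective z.
  move=> i j; case: (unliftP ord0 i) => [i'|] ->;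
    case: (unliftP ord0 j) => [j'|] ->; rewrite ?z0 ?zS //.
  - by move=> e; congr lift; apply/eqP; apply: contraTT (eqxx (y j'));
      rewrite -{1}e; exact: injy.
  - by move=> e; move: (yx i'); rewrite e eqxx.
  - by move=> e; move: (yx j'); rewrite e eqxx.
have zL j : 0 <= z j <= L.
  by case: (unliftP ord0 j) => [j'|] ->; rewrite ?z0 ?zS.
have [c cL] := divided_difference_mean dG injz zL.
pose W := \prod_l (x - y l).
pose P j := (y j - x) * \prod_(l | l != j) (y j - y l).
rewrite big_ord_recl z0.
have -> : \prod_(l | l != ord0) (x - z l) = W.
  rewrite big_mkcond big_ord_recl eqxx /= mul1r; apply: eq_bigr => l _.
  by rewrite zS.
have -> : \sum_j G 0%N (z (lift ord0 j)) /
      \prod_(l | l != lift ord0 j) (z (lift ord0 j) - z l) =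
    \sum_j G 0%N (y j) / P j.
  apply: eq_bigr => j _; rewrite zS; congr (_ / _).
  rewrite big_mkcond big_ord_recl /= z0; congr (_ * _).
  rewrite [RHS]big_mkcond; apply: eq_bigr => l _.
  by rewrite zS (inj_eq lift_inj).
have W0 : W != 0 by apply/prodf_neq0 => l _; rewrite subr_eq0 eq_sym.
have f0 : n.+1`!%:R != 0 :> R by rewrite pnatr_eq0 -lt0n fact_gt0.
move=> Gc.
have -> : G 0%N x =
    W / n.+1`!%:R * G n.+1 c - \sum_j (W / P j) * G 0%N (y j).
  have -> : \sum_j (W / P j) * G 0%N (y j) = W * \sum_j G 0%N (y j) / P j.
    by rewrite mulr_sumr; apply: eq_bigr => j _; rewrite mulrAC mulrA.
  by rewrite Gc; field; rewrite f0 W0.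
apply: (le_trans (ler_normB _ _)); apply: lerD.
  rewrite !normrM normfV normr_nat ler_pM ?GD //.
  rewrite ler_wpM2r ?invr_ge0 // /W normr_prod.
  apply: (@le_trans _ _ (\prod_(l < n.+1) L)).
    by apply: ler_prod => l _; rewrite normr_ge0 dist_le.
  by rewrite prodr_const card_ord.
apply: (le_trans (ler_norm_sum _ _ _)).
apply: (@le_trans _ _ (\sum_(j < n.+1)
    ((L / w) ^+ n * ((j`! * (n - j)`!)%:R)^-1) * rho)).
  apply: ler_sum => j _; rewrite normrM ler_pM //.
  (* The factor x - y_j of [W] cancels, which leaves n factors at most L over n separated
     differences. *)
  have -> : `|W / P j| = (\prod_(l | l != j) `|x - y l|) /
                         (\prod_(l | l != j) `|y j - y l|).
    rewrite normrM normfV /P normrM /W !normr_prod (bigD1 j) //= invfM.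
    rewrite mulrACA [`|y j - x|]distrC divff ?mul1r //.
    by rewrite normr_eq0 subr_eq0 eq_sym.
  rewrite exprMn -mulrA; apply: ler_pM; rewrite ?invr_ge0 ?prodr_ge0 //.
    apply: (@le_trans _ _ (\prod_(l < n.+1 | l != j) L)).
      by apply: ler_prod => l _; rewrite normr_ge0 dist_le.
    rewrite prodr_const (_ : #|_| = n) //.
    by have := cardC1 j; rewrite card_ord.
  rewrite -prod_dist_fact exprVn -invfM lef_pV2 ?posrE; last 2 first.
  - by apply: prodr_gt0 => l lj; rewrite normr_gt0 subr_eq0 injy // eq_sym.
  - rewrite mulr_gt0 ?exprn_gt0 //; apply: prodr_gt0 => l lj.
    by rewrite neq_dist // eq_sym.
  have -> : w ^+ n = \prod_(l < n.+1 | l != j) w.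
    rewrite prodr_const (_ : #|_| = n) //.
    by have := cardC1 j; rewrite card_ord.
  rewrite -big_split /=; apply: ler_prod => l lj.
  by rewrite sep mulr_ge0 // ltW.
rewrite -mulr_suml -mulr_sumr sum_inv_fact ler_wpM2r //.
by rewrite mulrA -exprMn [L / w * 2]mulrC !mulrA.
Qed.

(** With N = n+1, the condition N >= 4 e L makes (2 L)^N / N! at most 2^-N, and N >= 2
    [bernstein_const] makes 2^-N times that constant at most 1/2. The remainder is then at most half
    of the supremum and is absorbed. *)
Lemma exp_tower_remez m lam F L n (y : 'I_n.+1 -> R) (w rho : R) :
  exp_tower m lam F -> tower_bounded m F L -> (0 < m)%N -> 1 <= L ->
  (0 < n)%N -> 4 * expR 1 * L <= n.+1%:R ->
  2 * bernstein_const R m <= n.+1%:R -> 0 < w ->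
  (forall i j : 'I_n.+1, w * `|i%:R - j%:R| <= `|y i - y j|) ->
  (forall j, 0 <= y j <= L) -> (forall j, cmod (F 0%N 0%N (y j)) <= rho) ->
  forall x, 0 <= x <= L ->
  cmod (F 0%N 0%N x) <= 2 * (2 * expR 1 * (L / (w * n.+1%:R))) ^+ n.+1 * rho.
Proof.
move=> tF bF m0 L1 n0 NL NB w0 sep yL yrho x0 x0L.
have L0 : 0 < L by rewrite (lt_le_trans _ L1).
have e0 : 0 < expR 1 :> R by exact: expR_gt0.
have e2 : 2 <= expR 1 :> R by have := expR_ge1Dx (1 : R); lra.
have N0 : 0 < n.+1%:R :> R by rewrite ltr0n.
have rho0 : 0 <= rho by rewrite (le_trans _ (yrho ord0)) ?cmod_ge0.
set C := (2 * expR 1 * (L / (w * n.+1%:R))) ^+ n.+1.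
(* Nodes 0 and n are at least w n apart in [0, L]; with n + 1 <= 2 n this yields [C1] below. *)
have wL : w * n%:R <= L.
  have := sep ord_max ord0; rewrite subr0 normr_nat => /le_trans; apply.
  move: (yL ord0) (yL ord_max) => /andP[? ?] /andP[? ?].
  by rewrite ler_norml; apply/andP; split; lra.
have wN : 1 <= 2 * (L / (w * n.+1%:R)).
  rewrite mulrA ler_pdivlMr ?mulr_gt0 // mul1r.
  rewrite (@le_trans _ _ (2 * (w * n%:R))) ?ler_wpM2l //.
  rewrite mulrCA ler_wpM2l ?(ltW w0) // -natrM ler_nat mul2n -addnn.
  by rewrite -addn1 leq_add2l.
have C1 : 1 <= C.
  rewrite exprn_ege1 // mulrAC (le_trans wN) // ler_peMr //; last by lra.
  exact: le_trans ler01 wN.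
have sup_le M : (forall x, 0 <= x <= L -> cmod (F 0%N 0%N x) <= M) ->
    forall x, 0 <= x <= L -> cmod (F 0%N 0%N x) <= M / 2 + C * rho.
  move=> FM x xL.
  have M0 : 0 <= M by rewrite (le_trans _ (FM _ xL)) ?cmod_ge0.
  (* At a node the bound follows from C >= 1; interpolation needs x distinct from all nodes. *)
  have [/existsP[j /eqP yj]|/existsPn yx] := boolP [exists j, y j == x].
    rewrite -yj (le_trans (yrho j)) // ler_wpDl ?divr_ge0 //.
    by rewrite ler_peMl.
  have [u u1 <-] := cmod_rotation (F 0%N 0%N x).
  pose G i x := complex.Re (u * F 0%N i x).
  have dG : derivative_tower G by apply: complex_tower_Re; case: tF.
  have GF k z : `|G k z| <= cmod (F 0%N k z).
    by rewrite (le_trans (Re_le_cmod _)) // cmodM ler_piMl ?cmod_ge0.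
  have B0 := bernstein_const_ge0 R m.
  pose D := 2 ^+ n.+1 * (bernstein_const R m * M).
  have D0 : 0 <= D by rewrite !mulr_ge0 ?exprn_ge0.
  have GD c : 0 <= c <= L -> `|G n.+1 c| <= D.
    move=> cL; apply: (le_trans (GF _ _)).
    apply: (exp_tower_growth tF); first exact: mulr_ge0.
    by move=> j jm; apply: (exp_tower_bernstein tF bF).
  apply: (le_trans (ler_norm _)).
  apply: (le_trans (interpolation_bound dG w0 D0 sep yL _ GD xL yx)).
    by move=> j; rewrite (le_trans (GF _ _)) // yrho.
  have fge := fact_ge_exp R n; have f0 : 0 < n.+1`!%:R :> R.
    by rewrite ltr0n fact_gt0.
  have Ne0 : 0 < (n.+1%:R / expR 1) ^+ n.+1 :> R.
    by rewrite exprn_gt0 // divr_gt0.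
  apply: lerD.
    rewrite /D mulrA -[_ / _ * _]mulrAC -exprMn.
    have H1 : (L * 2) ^+ n.+1 / n.+1`!%:R <= (2^-1) ^+ n.+1.
      rewrite ler_pdivrMr //; apply: (@le_trans _ _
          (2^-1 ^+ n.+1 * (n.+1%:R / expR 1) ^+ n.+1)); last first.
        by rewrite ler_wpM2l // exprn_ge0 // invr_ge0.
      rewrite -exprMn lerXn2r ?nnegrE ?mulr_ge0 ?invr_ge0 ?(ltW L0)
        ?(ltW e0) //.
      by rewrite mulrA ler_pdivlMr //; lra.
    apply: (@le_trans _ _ (2^-1 ^+ n.+1 * (bernstein_const R m * M))).
      by rewrite ler_wpM2r // mulr_ge0.
    rewrite mulrA [leRHS]mulrC ler_wpM2r // exprVn mulrC.
    rewrite ler_pdivrMr ?exprn_gt0 // ler_pdivlMl //.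
    by rewrite (le_trans NB) // -natrX ler_nat ltnW // ltn_expl.
  rewrite ler_wpM2r //.
  (* Writing 1 / n! as (n+1) / (n+1)! lets the same factorial estimate serve for both terms. *)
  have -> : (2 * L / w) ^+ n / n`!%:R =
      n.+1%:R * ((2 * L / w) ^+ n / n.+1`!%:R).
    by rewrite factS natrM invfM [RHS]mulrCA mulVKf ?gt_eqF.
  apply: (@le_trans _ _ (n.+1%:R * ((2 * L / w) ^+ n /
      (n.+1%:R / expR 1) ^+ n.+1))).
    rewrite ler_wpM2l // ler_wpM2l ?lef_pV2 ?posrE //.
    by rewrite exprn_ge0 // divr_ge0 ?mulr_ge0 ?ltW.
  have -> : n.+1%:R * ((2 * L / w) ^+ n / (n.+1%:R / expR 1) ^+ n.+1) =
      expR 1 * (2 * expR 1 * (L / (w * n.+1%:R))) ^+ n.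
    have -> : 2 * L / w = 2 * expR 1 * (L / (w * n.+1%:R)) *
        (n.+1%:R / expR 1) by field; rewrite !gt_eqF.
    rewrite exprMn exprS; field.
    by rewrite expf_neq0 ?mulf_neq0 ?invr_neq0 ?gt_eqF.
  have H0 : 0 <= L / (w * n.+1%:R) by rewrite divr_ge0 ?mulr_ge0 ?ltW.
  (* The spare factor e is at most 2 e L / (w (n+1)), by [wN]. *)
  rewrite /C exprS; apply: ler_wpM2r; last by rewrite mulrAC ler_peMl // ltW.
  apply: exprn_ge0; apply: mulr_ge0 => //; apply: mulr_ge0 => //; exact: ltW.
pose E := [set cmod (F 0%N 0%N x) | x in [set x | 0 <= x <= L]].
have supE : has_sup E.
  split; first by exists (cmod (F 0%N 0%N x0)), x0.
  by case: bF => B FB; exists B => _ [x xL <-]; exact: FB.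
have FM x : 0 <= x <= L -> cmod (F 0%N 0%N x) <= sup E.
  by move=> xL; apply: ub_le_sup; [case: supE|exists x].
have : sup E <= sup E / 2 + C * rho.
  apply: ge_sup => [|_ [x xL <-]]; first by case: supE.
  exact: sup_le.
have := FM _ x0L; rewrite -mulrA.
by move: (C * rho) => Cr; lra.
Qed.

End RemezTower.

(** * Derivatives of complex functions of a real variable *)

Section ComplexDerivative.
Variable R : realType.
Implicit Types (f g : R -> R[i]) (x : R) (a b : R[i]).

Definition is_cderive f x a :=
  is_derive x 1 (fun y => complex.Re (f y)) (complex.Re a) /\
  is_derive x 1 (fun y => complex.Im (f y)) (complex.Im a).

Lemma is_cderive_cst x a : is_cderive (fun=> a) x 0.
Proof. by split; exact: is_derive_cst. Qed.

Lemma is_cderive_id x : is_cderive (fun y => y%:C%C) x 1.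
Proof. by split; [exact: is_derive_id|exact: is_derive_cst]. Qed.

Lemma is_cderiveD f g x a b : is_cderive f x a -> is_cderive g x b ->
  is_cderive (fun y => f y + g y) x (a + b).
Proof.
move=> [fR fI] [gR gI]; split.
  rewrite (_ : (fun y => complex.Re (f y + g y)) =
    (fun y => complex.Re (f y)) \+ (fun y => complex.Re (g y))); last first.
    by apply/funext => y /=; case: (f y) (g y) => ? ? [].
  have -> : complex.Re (a + b) = complex.Re a + complex.Re b.
    by case: a {fR fI}; case: b {gR gI}.
  exact: is_deriveD.
rewrite (_ : (fun y => complex.Im (f y + g y)) =
  (fun y => complex.Im (f y)) \+ (fun y => complex.Im (g y))); last first.
  by apply/funext => y /=; case: (f y) (g y) => ? ? [].
have -> : complex.Im (a + b) = complex.Im a + complex.Im b.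
  by case: a {fR fI}; case: b {gR gI}.
exact: is_deriveD.
Qed.

Lemma is_cderiveM f g x a b : is_cderive f x a -> is_cderive g x b ->
  is_cderive (fun y => f y * g y) x (a * g x + f x * b).
Proof.
move=> [fR fI] [gR gI].
have fgR := is_deriveM fR gR; have fgI := is_deriveM fI gI.
have fRgI := is_deriveM fR gI; have fIgR := is_deriveM fI gR.
split.
  rewrite (_ : (fun y => complex.Re (f y * g y)) =
    (fun y => complex.Re (f y)) * (fun y => complex.Re (g y)) -
    (fun y => complex.Im (f y)) * (fun y => complex.Im (g y))); last first.
    by apply/funext => y /=; rewrite !fctE; case: (f y) (g y) => ? ? [].
  apply: (is_derive_eq (is_deriveB fgR fgI)).
  case: a b (f x) (g x) {fR fI gR gI fgR fgI fRgI fIgR}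
    => a1 a2 [b1 b2] [f1 f2] [g1 g2] /=.
  rewrite /GRing.scale /=; ring.
rewrite (_ : (fun y => complex.Im (f y * g y)) =
  (fun y => complex.Re (f y)) * (fun y => complex.Im (g y)) +
  (fun y => complex.Im (f y)) * (fun y => complex.Re (g y))); last first.
  apply/funext => y /=; rewrite !fctE.
  by case: (f y) (g y) => ? ? [] * /=; ring.
apply: (is_derive_eq (is_deriveD fRgI fIgR)).
case: a b (f x) (g x) {fR fI gR gI fgR fgI fRgI fIgR}
    => a1 a2 [b1 b2] [f1 f2] [g1 g2] /=.
rewrite /GRing.scale /=; ring.
Qed.

Lemma is_cderive_sum (I : Type) (r : seq I) (f : I -> R -> R[i]) x
    (a : I -> R[i]) :
  (forall i, is_cderive (f i) x (a i)) ->
  is_cderive (fun y => \sum_(i <- r) f i y) x (\sum_(i <- r) a i).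
Proof.
move=> fa; elim: r => [|i r IH].
  rewrite big_nil (_ : (fun _ => _) = fun=> 0); first exact: is_cderive_cst.
  by apply/funext => y; rewrite big_nil.
rewrite big_cons (_ : (fun _ => _) = fun y => f i y + \sum_(i <- r) f i y).
  exact: is_cderiveD.
by apply/funext => y; rewrite big_cons.
Qed.

Lemma is_cderive_horner (p : {poly R[i]}) x :
  is_cderive (fun y => p.[y%:C%C]) x p^`().[x%:C%C].
Proof.
elim/poly_ind: p => [|p c IH].
  rewrite deriv0 horner0 (_ : (fun _ => _) = fun=> 0).
    exact: is_cderive_cst.
  by apply/funext => y; rewrite horner0.
rewrite derivMXaddC hornerD hornerMX.
rewrite (_ : (fun _ => _) = fun y => p.[y%:C%C] * y%:C%C + c); last first.
  by apply/funext => y; rewrite hornerD hornerMX hornerC.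
rewrite -[X in is_cderive _ _ X]addr0.
apply: is_cderiveD; last exact: is_cderive_cst.
rewrite addrC -[p.[_] in X in is_cderive _ _ X]mulr1.
by apply: is_cderiveM => //; exact: is_cderive_id.
Qed.

Lemma is_cderive_cexp a x :
  is_cderive (fun y => cexp (a * y%:C%C)) x (a * cexp (a * x%:C%C)).
Proof.
have E y : a * y%:C%C = (complex.Re a * y +i* (complex.Im a * y))%C.
  case: a => u v; apply/eqP; rewrite eq_complex /=.
  by apply/andP; split; apply/eqP; ring.
case: a E => u v E; rewrite /= in E.
have dl (c : R) : is_derive x 1 ( *%R c) c.
  rewrite -[X in is_derive _ _ _ X]mulr1.
  exact: (is_deriveZ c (is_derive_id x 1)).
have dE : is_derive x 1 (expR \o *%R u) (expR (u * x) * u).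
  exact: is_derive1_comp.
have dC : is_derive x 1 (cos \o *%R v) (- sin (v * x) * v).
  exact: is_derive1_comp.
have dS : is_derive x 1 (sin \o *%R v) (cos (v * x) * v).
  exact: is_derive1_comp.
split.
  rewrite (_ : (fun y => _) = (expR \o *%R u) * (cos \o *%R v)); last first.
    by apply/funext => y; rewrite E.
  apply: (is_derive_eq (is_deriveM dE dC)).
  by rewrite E /GRing.scale /=; ring.
rewrite (_ : (fun y => _) = (expR \o *%R u) * (sin \o *%R v)); last first.
  by apply/funext => y; rewrite E.
apply: (is_derive_eq (is_deriveM dE dS)).
by rewrite E /GRing.scale /=; ring.
Qed.

Lemma cmod_cexp a : cmod (cexp a) = expR (complex.Re a).
Proof.
rewrite /cmod /cexp /= !exprMn -mulrDr cos2Dsin2 mulr1 sqrtr_sqr.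
by rewrite ger0_norm // expR_ge0.
Qed.

Lemma cexpD a b : cexp (a + b) = cexp a * cexp b.
Proof.
case: a b => a1 a2 [b1 b2]; rewrite /cexp /= expRD cosD sinD.
by apply/eqP; rewrite eq_complex /=; apply/andP; split; apply/eqP; ring.
Qed.

End ComplexDerivative.

(** * A Remez inequality for exponential polynomials *)

Section ExponentialPolynomial.
Variables (R : realType) (k : nat) (lam : 'I_k -> R[i]).
Implicit Types (P : 'I_k -> {poly R[i]}) (x : R) (a : R[i]).

Definition exp_poly P x : R[i] :=
  \sum_j (P j).[x%:C%C] * cexp (lam j * x%:C%C).

(* The coefficients of (D - a) q, when those of q are P. *)
Definition diff_shift a P j : {poly R[i]} := (P j)^`() + (lam j - a) *: P j.

Lemma exp_poly_derive P x :
  is_cderive (exp_poly P) x (exp_poly (diff_shift 0 P) x).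
Proof.
apply: is_cderive_sum => j; rewrite /diff_shift subr0 hornerD mulrDl hornerZ.
rewrite [lam j * (P j).[_]]mulrC -mulrA.
by apply: is_cderiveM; [exact: is_cderive_horner|exact: is_cderive_cexp].
Qed.

Lemma iter_diff_shiftB i a P Q j :
  iter i (diff_shift 0) (fun j => P j - a *: Q j) j =
  iter i (diff_shift 0) P j - a *: iter i (diff_shift 0) Q j.
Proof.
elim: i j => //= i IH j; rewrite /diff_shift !IH derivB derivZ !subr0.
by rewrite scalerBr scalerDr !scalerA [lam j * a]mulrC opprD addrACA.
Qed.

Lemma exp_polyB P Q a x :
  exp_poly (fun j => P j - a *: Q j) x = exp_poly P x - a * exp_poly Q x.
Proof.
rewrite /exp_poly mulr_sumr -sumrB; apply: eq_bigr => j _.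
by rewrite hornerD hornerN hornerZ mulrBl mulrA.
Qed.

(** A crude bound on [0, L], whose only purpose is to establish [tower_bounded]. *)
Definition exp_poly_bound P (L : R) : R :=
  \sum_j (\sum_(i < size (P j)) cmod (P j)`_i * L ^+ i)
         * expR (cmod (lam j) * L).

Lemma exp_poly_le_bound P x L : 0 <= x <= L ->
  cmod (exp_poly P x) <= exp_poly_bound P L.
Proof.
case/andP=> x0 xL; apply: (le_trans (cmod_sum _ _ _)).
apply: ler_sum => j _; rewrite cmodM ler_pM ?cmod_ge0 //.
  rewrite horner_coef (le_trans (cmod_sum _ _ _)) //.
  apply: ler_sum => i _; rewrite cmodM cmodX cmod_real ger0_norm //.
  by rewrite ler_wpM2l ?cmod_ge0 // lerXn2r // nnegrE // (le_trans x0).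
rewrite cmod_cexp ler_expR (le_trans (ler_norm _)) //.
rewrite (le_trans (Re_le_cmod _)) // cmodM cmod_real ger0_norm //.
by rewrite ler_wpM2l ?cmod_ge0.
Qed.

(** Repeating exponent j as often as [d j] gives an order for the factors D - lam of the operator
    that annihilates the exponential polynomial. *)
Lemma seq_with_multiplicities (d : 'I_k -> nat) :
  exists s : seq 'I_k, size s = (\sum_j d j)%N /\
                       forall j, count_mem j s = d j.
Proof.
exists (flatten [seq nseq (d j) j | j <- enum 'I_k]); split.
  rewrite size_flatten /shape -map_comp sumnE big_map big_enum /=.
  by apply: eq_bigr => j _; rewrite size_nseq.
move=> j; rewrite count_flatten -map_comp sumnE big_map big_enum /=.
rewrite (bigD1 j) //= count_nseq /= eqxx mul1n big1 ?addn0 // => l lj.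
by rewrite count_nseq /= (negPf lj).
Qed.

(** Applying D - lam_l lowers the degree of the coefficient of exponent l and does not raise the
    others. Hence the m factors, exponent l taken [d l] times, annihilate the function, and the
    inequality for towers applies. *)
Theorem exp_poly_remez P (d : 'I_k -> nat) L n (y : 'I_n.+1 -> R) (w rho : R) :
  let m := (\sum_j d j)%N in
  (forall j, (size (P j) <= d j)%N) -> (forall j, cmod (lam j) <= 1) ->
  (0 < m)%N -> 1 <= L -> (0 < n)%N -> 4 * expR 1 * L <= n.+1%:R ->
  2 * bernstein_const R m <= n.+1%:R -> 0 < w ->
  (forall i j : 'I_n.+1, w * `|i%:R - j%:R| <= `|y i - y j|) ->
  (forall j, 0 <= y j <= L) -> (forall j, cmod (exp_poly P (y j)) <= rho) ->
  forall x, 0 <= x <= L ->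
  cmod (exp_poly P x) <= 2 * (2 * expR 1 * (L / (w * n.+1%:R))) ^+ n.+1 * rho.
Proof.
move=> m Pd lam1.
have [s [sz cs]] := seq_with_multiplicities d.
(* Beyond the list the default is 0, which still has modulus at most 1. *)
pose mu j := nth 0 [seq lam l | l <- s] j.
pose Q := fix Q j := if j is j'.+1 then diff_shift (mu j') (Q j') else P.
pose F j i := exp_poly (iter i (diff_shift 0) (Q j)).
have size_deriv_le (p : {poly R[i]}) : (size p^`() <= (size p).-1)%N.
  exact: size_poly.
(* The invariant: the size of the coefficient of exponent l is at most the number of entries l not
   yet applied. *)
have sQ j l : (j <= m)%N -> (size (Q j l) <= count_mem l (drop j s))%N.
  elim: j l => [|j IH] l jm; first by rewrite drop0 cs Pd.
  have js : (j < size s)%N by rewrite sz.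
  have := IH l (ltnW jm); rewrite (drop_nth l js) /= /diff_shift.
  have -> : mu j = lam (nth l s j) by rewrite /mu (nth_map l).
  have [->|_] := eqVneq (nth l s j) l => le1.
    rewrite subrr scale0r addr0 (leq_trans (size_deriv_le _)) //.
    by case: (size _) le1.
  rewrite (leq_trans (size_polyD _ _)) // geq_max.
  rewrite (leq_trans (size_deriv_le _)) ?(leq_trans (leq_pred _)) //=.
  by rewrite (leq_trans (size_scale_leq _ _)).
have tF : exp_tower m mu F.
  split.
  - by move=> i x; exact: exp_poly_derive.
  - move=> j i x; rewrite /F iterSr -exp_polyB; congr exp_poly.
    rewrite -[RHS](_ : iter i (diff_shift 0)
      (fun l => diff_shift 0 (Q j) l - mu j *: Q j l) = _).
      congr iter; apply/funext => l.
      by rewrite /= /diff_shift subr0 scalerBl addrA.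
    by apply/funext => l; exact: iter_diff_shiftB.
  - move=> i x; rewrite /F /exp_poly big1 // => l _.
    suff -> : iter i (diff_shift 0) (Q m) l = 0 by rewrite horner0 mul0r.
    elim: i l => [|i IH] l /=.
      apply/eqP; rewrite -size_poly_eq0 -leqn0.
      by rewrite (leq_trans (sQ m l _)) // drop_oversize // sz.
    by rewrite /diff_shift IH deriv0 scaler0 addr0.
  - move=> j; rewrite /mu; have [js|js] := ltnP j (size s).
      case: (s) js => // l s' js.
      by rewrite (nth_map l).
    by rewrite nth_default ?size_map // cmod0.
have bF : tower_bounded m F L.
  exists (\sum_(j < m) `|exp_poly_bound (Q j) L|) => j x jm xL.
  apply: (le_trans (exp_poly_le_bound _ xL)); apply: (le_trans (ler_norm _)).
  rewrite (bigD1 (Ordinal jm)) //= lerDl.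
  by rewrite sumr_ge0.
exact: (exp_tower_remez tF bF).
Qed.

End ExponentialPolynomial.

(** * Restriction of quasipolynomials to lines *)

Section LineRestriction.
Variable R : realType.

(** Along a line a monomial becomes a product of as many polynomials of degree at most 1 as its
    degree. *)
Lemma mpoly_line n (q : mpoly.mpoly n R[i]) (a b : 'I_n -> R[i]) :
  exists2 P : {poly R[i]}, (size P <= mpoly.msize q)%N &
    forall s, P.[s] = mpoly.meval (fun i => a i + s * b i) q.
Proof.
pose Q (e : mpoly.multinom n) := \prod_i ((a i)%:P + b i *: 'X) ^+ e i.
have sQ e : (size (Q e) <= (mpoly.mdeg e).+1)%N.
  rewrite mpoly.mdegE /Q.
  apply: (big_ind2 (fun (P : {poly R[i]}) d => (size P <= d.+1)%N)).
  - by rewrite size_poly1.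
  - move=> P1 d1 P2 d2 h1 h2; apply: (leq_trans (size_polyMleq _ _)).
    by move: h1 h2; lia.
  - move=> i _; apply: (leq_trans (size_poly_exp_leq _ _)); rewrite ltnS.
    rewrite -[leqRHS]mul1n leq_mul2r; apply/orP; right.
    have : (size ((a i)%:P + b i *: 'X)%R <= 2)%N.
      rewrite (leq_trans (size_polyD _ _)) // geq_max.
      rewrite (leq_trans (size_polyC_leq1 _)) //=.
      by rewrite (leq_trans (size_scale_leq _ _)) // size_polyX.
    by case: (size _).
exists (\sum_(e <- mpoly.msupp q) mpoly.mcoeff e q *: Q e).
  apply: (leq_trans (size_sum _ _ _)); rewrite big_seq.
  apply/bigmax_leqP_seq => e _ eq; rewrite (leq_trans (size_scale_leq _ _)) //.
  by rewrite (leq_trans (sQ e)) // mpoly.msize_mdeg_lt.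
move=> s; rewrite mpoly.mevalE horner_sum; apply: eq_bigr => e _.
rewrite hornerZ /Q horner_prod; congr (_ * _); apply: eq_bigr => i _.
by rewrite horner_exp hornerD hornerC hornerZ hornerX mulrC.
Qed.

Lemma enorm_ge0 n (v : 'rV[R]_n) : 0 <= enorm v.
Proof. exact: sqrtr_ge0. Qed.

Lemma enormZ n (a : R) (v : 'rV[R]_n) : enorm (a *: v) = `|a| * enorm v.
Proof.
rewrite /enorm -sqrtr_sqr -sqrtrM ?sqr_ge0 // mulr_sumr.
by congr Num.sqrt; apply: eq_bigr => i _; rewrite mxE exprMn.
Qed.

Lemma enorm_eq0 n (v : 'rV[R]_n) : enorm v = 0 -> v = 0.
Proof.
move=> /eqP; rewrite /enorm sqrtr_eq0 => v0; apply/rowP => i; rewrite mxE.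
apply/eqP; rewrite -sqrf_eq0 eq_le sqr_ge0 andbT (le_trans _ v0) //.
by rewrite (bigD1 i) //= lerDl sumr_ge0 // => j _; exact: sqr_ge0.
Qed.

Local Notation toC := (map_mx (fun r : R => r%:C%C)).

Lemma qp_type_ge0 n k (p : quasipoly R n k) : 0 <= qp_type p.
Proof. exact: bigmax_ge_id. Qed.

(** By homogeneity it suffices to take a unit vector, and a real unit vector lies in the complex
    ball. *)
Lemma cdot_le_qp_type n k (p : quasipoly R n k) j (v : 'rV[R]_n) :
  cmod (cdot (qp_exp p j) (toC v)) <= qp_type p * enorm v.
Proof.
have [v0|v0] := eqVneq (enorm v) 0.
  rewrite (enorm_eq0 v0) /cdot big1 ?cmod0 ?mulr_ge0 ?qp_type_ge0 ?enorm_ge0 //.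
  by move=> i _; rewrite !mxE mulr0.
have vp : 0 < enorm v by rewrite lt_neqAle eq_sym v0 enorm_ge0.
pose z := (enorm v)^-1 *: v.
have z1 : enorm z = 1 by rewrite enormZ ger0_norm ?invr_ge0 ?enorm_ge0 // mulVf.
have -> : cdot (qp_exp p j) (toC v) =
    (enorm v)%:C%C * cdot (qp_exp p j) (toC z).
  rewrite /cdot mulr_sumr; apply: eq_bigr => i _.
  rewrite !mxE mulrCA -rmorphM /=.
  by rewrite mulVKf.
rewrite cmodM cmod_real ger0_norm ?enorm_ge0 // mulrC ler_wpM2r ?enorm_ge0 //.
apply: le_trans (le_bigmax _ _ j); apply: ub_le_sup; last first.
  exists (toC z) => //; rewrite /cball /= -[leRHS]z1 /enorm.
  rewrite (eq_bigr (fun i => z 0 i ^+ 2)) // => i _.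
  by rewrite mxE cmod_real real_normK ?num_real.
(* The supremum in [qp_type] must be over a bounded set: on the ball each coordinate has modulus at
   most 1. *)
exists (\sum_i cmod (qp_exp p j 0 i)) => _ [w w1 <-].
apply: (le_trans (cmod_sum _ _ _)); apply: ler_sum => i _.
rewrite cmodM ler_piMr ?cmod_ge0 // -(@expr_le1 _ 2) ?cmod_ge0 //.
apply: le_trans (_ : \sum_i cmod (w 0 i) ^+ 2 <= 1).
  by rewrite (bigD1 i) //= lerDl sumr_ge0 // => l _; exact: sqr_ge0.
move: w1; rewrite /cball /= -[X in _ <= X -> _]sqrtr1 ler_sqrt //.
Qed.

(** The factor exp(f . x) is constant along the line and goes into the coefficient; the frequency on
    the line is f . v. *)
Lemma qp_line n k (p : quasipoly R n k) (x v : 'rV[R]_n) :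
  exists (lam : 'I_k -> R[i]) (P : 'I_k -> {poly R[i]}),
    [/\ forall j, (size (P j) <= (qp_deg p j).+1)%N,
        forall j, cmod (lam j) <= qp_type p * enorm v &
        forall u, qp_abs p (x + u *: v) = cmod (exp_poly lam P u)].
Proof.
have line j :=
  mpoly_line (qp_coef p j) (fun i => toC x 0 i) (fun i => toC v 0 i).
pose P j := s2val (cid2 (line j)).
have sP j : (size (P j) <= mpoly.msize (qp_coef p j))%N :=
  s2valP (cid2 (line j)).
have PE j := s2valP' (cid2 (line j)).
exists (fun j => cdot (qp_exp p j) (toC v)).
exists (fun j => cexp (cdot (qp_exp p j) (toC x)) *: P j); split.
- move=> j; rewrite (leq_trans (size_scale_leq _ _)) // (leq_trans (sP j)) //.
  by rewrite /qp_deg leqSpred.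
- by move=> j; exact: cdot_le_qp_type.
- move=> u; rewrite /qp_abs /qp_eval /exp_poly; congr cmod.
  apply: eq_bigr => j _; rewrite hornerZ [in RHS]mulrC mulrA -cexpD mulrC.
  rewrite /P PE; congr (_ * cexp _).
    apply: mpoly.meval_eq => i.
    by rewrite !mxE rmorphD rmorphM.
  rewrite /cdot mulr_suml -big_split /=; apply: eq_bigr => i _.
  by rewrite !mxE rmorphD rmorphM /=; ring.
Qed.

End LineRestriction.

(** * Lebesgue measure of slices and contractions *)

Section LebesgueSlices.
Variable R : realType.
Local Notation MR := (measurableTypeR R).
Local Notation mu := (@lebesgue_measure R).
Local Open Scope ereal_scope.

(** Measurability of sets of row vectors is tested through this map, on the product sigma-algebra of
    tuples. *)
Definition row_of_tuple n (t : n.-tuple MR) : 'rV[R]_n :=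
  (\row_i (tnth t i : R))%R.

Lemma row_of_cons n (a : MR) (t : n.-tuple MR) :
  row_of_tuple [the n.+1.-tuple MR of a :: t] =
  (row_mx (a : R)%:M (row_of_tuple t) : 'rV[R]_(1 + n)).
Proof.
apply/rowP => i; rewrite mxE mxE; case: splitP => j ij.
  rewrite ord1 !mxE eqxx mulr1n (_ : i = ord0) //.
  by apply/val_inj; rewrite /= ij ord1.
rewrite !mxE (_ : i = lift ord0 j) ?tnthS //.
exact/val_inj.
Qed.

Definition row_measurable n (A : set 'rV[R]_n) :=
  measurable [set t : n.-tuple MR | A (row_of_tuple t)].

Definition slice n (A : set 'rV[R]_n.+1) (a : R) : set 'rV[R]_n :=
  [set y | A (row_mx a%:M y : 'rV[R]_(1 + n))].

Lemma leb_ge0 n (A : set 'rV[R]_n) : 0 <= leb A.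
Proof.
by elim: n A => [|n IH] A //=; apply: integral_ge0 => x _; exact: IH.
Qed.

(* The parameter space T absorbs the integrated coordinate in the induction
   on n. *)
Lemma measurable_leb_family n : forall d (T : measurableType d)
    (S : T -> set 'rV[R]_n),
  measurable [set z : T * n.-tuple MR | S z.1 (row_of_tuple z.2)] ->
  measurable_fun setT (fun x => leb (S x)).
Proof.
elim: n => [|n IH] d T S mS /=.
  have mA : measurable [set x | S x 0%R].
    have mp : measurable_fun [set: T] (fun x : T => (x, [tuple] : 0.-tuple MR)).
      exact: measurable_fun_pair.
    have := mp measurableT _ mS; rewrite setTI.
    rewrite (_ : _ @^-1` _ = [set x | S x 0%R]) //.
    apply/seteqP; split => x /=.
      by rewrite (_ : row_of_tuple _ = 0%R) //; apply/rowP => -[].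
    by rewrite (_ : row_of_tuple _ = 0%R) //; apply/rowP => -[].
  rewrite (_ : (fun x => _) = EFin \o \1_[set x | S x 0%R]).
    exact/measurable_EFinP/measurable_indic.
  by apply/funext => x /=; rewrite !indicE; congr (_%:R)%:E;
    apply/idP/idP; rewrite !inE.
have mF : measurable_fun setT (fun z : T * MR => leb (slice (S z.1) z.2)).
  apply: IH.
  have mp : measurable_fun setT (fun z : (T * MR) * n.-tuple MR =>
      (z.1.1, [the n.+1.-tuple MR of z.1.2 :: z.2])).
    apply: measurable_fun_pair => /=.
      exact: (measurableT_comp measurable_fst measurable_fst).
    apply: measurable_cons => //.
    exact: (measurableT_comp measurable_snd measurable_fst).
  have := mp measurableT _ mS; rewrite setTI.
  rewrite (_ : _ @^-1` _ =
    [set z | slice (S z.1.1) z.1.2 (row_of_tuple z.2)]) //.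
  by apply/seteqP; split => z /=; rewrite row_of_cons.
apply: (@measurable_fun_fubini_tonelli_F _ _ _ _ _ mu _ mF) => z.
exact: leb_ge0.
Qed.

Lemma measurable_slice n (A : set 'rV[R]_n.+1) a :
  row_measurable A -> row_measurable (slice A a).
Proof.
move=> mA.
have mp : measurable_fun setT
    (fun t : n.-tuple MR => [the n.+1.-tuple MR of (a : MR) :: t]).
  exact: measurable_cons.
have := mp measurableT _ mA; rewrite setTI.
rewrite (_ : _ @^-1` _ = [set t | slice A a (row_of_tuple t)]) //.
by apply/seteqP; split => z /=; rewrite row_of_cons.
Qed.

Lemma measurable_leb_slice n (A : set 'rV[R]_n.+1) :
  row_measurable A -> measurable_fun [set: MR] (fun a : MR => leb (slice A a)).
Proof.
move=> mA; apply: measurable_leb_family.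
have mp : measurable_fun setT
    (fun z : MR * n.-tuple MR => [the n.+1.-tuple MR of z.1 :: z.2]).
  exact: measurable_cons.
have := mp measurableT _ mA; rewrite setTI.
rewrite (_ : _ @^-1` _ = [set z | slice A z.1 (row_of_tuple z.2)]) //.
by apply/seteqP; split => z /=; rewrite row_of_cons.
Qed.

Lemma leb0 n : leb (set0 : set 'rV[R]_n) = 0.
Proof.
elim: n => [|n IH] /=; first by rewrite indicE in_set0.
by rewrite integral0_eq // => x _; rewrite -[RHS]IH.
Qed.

Lemma Q1_row n (a : R) (y : 'rV[R]_n) :
  Q1 (row_mx a%:M y : 'rV[R]_(1 + n)) <-> (0 <= a <= 1)%R /\ Q1 y.
Proof.
split=> [Q|[a01 Qy] i].
  split=> [|i]; first by have := Q (lshift n ord0); rewrite row_mxEl mxE eqxx.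
  by have := Q (rshift 1 i); rewrite row_mxEr.
rewrite mxE; case: splitP => j _; last exact: Qy.
by rewrite ord1 mxE eqxx.
Qed.

Lemma slice_Q1 n (A : set 'rV[R]_n.+1) a : A `<=` @Q1 R n.+1 ->
  slice A a `<=` @Q1 R n.
Proof. by move=> AQ y /AQ /Q1_row[]. Qed.

(** The slices at a outside [0, 1] are empty, so the outer integral may be restricted. *)
Lemma lebS n (A : set 'rV[R]_n.+1) : A `<=` @Q1 R n.+1 ->
  leb A = \int[mu]_(a in `[0%R, 1%R]) leb (slice A a).
Proof.
move=> AQ /=; rewrite [RHS]integral_mkcond; apply: eq_integral => a _.
rewrite patchE; case: ifPn => // /negP a01.
rewrite -[RHS](leb0 n); congr leb; apply/seteqP; split => // y /AQ /Q1_row[].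
by move=> h; exfalso; apply: a01; rewrite inE /= in_itv.
Qed.

Lemma lebesgue_measure01 : mu `[0%R, 1%R] = 1.
Proof. by rewrite lebesgue_measure_itv /= lte_fin ltr01 oppr0 adde0. Qed.

Lemma leb_le1 n (A : set 'rV[R]_n) : row_measurable A -> A `<=` @Q1 R n ->
  leb A <= 1.
Proof.
elim: n A => [|n IH] A mA AQ; first by rewrite /= lee_fin indicE lern1 leq_b1.
rewrite lebS // -[leRHS]mul1e -[X in _ <= _ * X]lebesgue_measure01.
rewrite -integral_cst //.
apply: ge0_le_integral => //.
- by move=> a _; exact: leb_ge0.
- by apply: measurable_funTS; exact: measurable_leb_slice.
- by move=> a _; apply: IH; [exact: measurable_slice|exact: slice_Q1].
Qed.

Lemma leb_Q1 n : leb (@Q1 R n) = 1.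
Proof.
elim: n => [|n IH].
  by rewrite /= indicE mem_set //; case.
rewrite lebS // -[RHS]mul1e -[X in _ = _ * X]lebesgue_measure01.
rewrite -integral_cst //.
apply: eq_integral => a; rewrite inE /= in_itv /= => a01.
rewrite -[RHS]IH; congr leb; apply/seteqP; split => y.
  by move/Q1_row => [].
by move=> Qy; apply/Q1_row.
Qed.

End LebesgueSlices.

Section Homothety.
Variable R : realType.
Local Notation MR := (measurableTypeR R).
Local Notation mu := (@lebesgue_measure R).
Local Open Scope ereal_scope.

Lemma measurable_homothety (c r : R) :
  measurable_fun [set: MR] (fun x : MR => (c + r * (x - c))%R : MR).
Proof.
apply: measurable_funD => //; apply: measurable_funM => //.
exact: measurable_funB.
Qed.

(** Pushed forward by the homothety, r times Lebesgue measure gives each half-open interval its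
    length, so it is Lebesgue measure by uniqueness. *)
Lemma ge0_integral_homothety (c r : R) (D : set MR) (f : MR -> \bar R) :
  (0 < r)%R -> measurable D -> measurable_fun D f ->
  (forall x, D x -> 0 <= f x) ->
  \int[mu]_(x in D) f x =
  r%:E * \int[mu]_(x in (fun x : MR => (c + r * (x - c))%R : MR) @^-1` D)
           f (c + r * (x - c))%R.
Proof.
move=> r0 mD mf f0.
set h := fun x : MR => (c + r * (x - c))%R : MR.
have mh : measurable_fun setT h by exact: measurable_homothety.
have r0' : (0 <= r)%R by exact: ltW.
pose m : {measure set MR -> \bar R} := mscale (NngNum r0') mu.
have mE A : measurable A -> pushforward m h A = mu A.
  move=> mA; apply/esym/lebesgue_measure_unique => //= _ [[a b]] _ <-.
  rewrite /m /mscale /= /pushforward /mscale /=.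
  rewrite (_ : h @^-1` _ = `](c + (a - c) / r)%R, (c + (b - c) / r)%R]%classic).
    rewrite !lebesgue_measure_itv /= !lte_fin ltrD2l ltr_pM2r ?invr_gt0 //.
    rewrite ltrD2r; case: ifP => ab; last by rewrite mule0.
    by rewrite -!EFinB -EFinM; congr EFin; field; rewrite gt_eqF.
  apply/seteqP; split => x /=; rewrite !in_itv /= => /andP[ax xb].
    by rewrite -ltrBrDl -lerBlDl ltr_pdivrMr // ler_pdivlMr //; apply/andP;
      split; move: ax xb; rewrite /h mulrC; lra.
  move: ax xb; rewrite -ltrBrDl -lerBlDl ltr_pdivrMr // ler_pdivlMr //.
  by move=> ax xb; apply/andP; split; move: ax xb; rewrite /h mulrC; lra.
rewrite -[r%:E]/((NngNum r0')%:num%:E) -ge0_integral_mscale //.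
- rewrite -(ge0_integral_pushforward mh m mD mf); last first.
    by move=> x; rewrite inE; exact: f0.
  by apply: eq_measure_integral => A mA _; exact/esym/mE.
- by rewrite -[X in measurable X]setTI; exact: mh.
- apply: (measurable_comp mD) => //; first by move=> _ [x Dx <-].
  exact: measurable_funTS.
- by move=> x; exact: f0.
Qed.

(** The image [J] of [0, 1] under the homothety contributes r <= 1 times the transformed integral;
    the rest [K] of [0, 1] has length 1 - r, and f is at most 1 there. *)
Lemma integral_homothety_le (c r : R) (f : MR -> \bar R) :
  (0 <= c <= 1)%R -> (0 < r <= 1)%R -> measurable_fun setT f ->
  (forall x, 0 <= f x) -> (forall x, (0 <= x <= 1)%R -> f x <= 1) ->
  \int[mu]_(x in `[0%R, 1%R]) f x <=
  \int[mu]_(x in `[0%R, 1%R]) f (c + r * (x - c))%R + (1 - r)%:E.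
Proof.
move=> /andP[c0 c1] /andP[r0 r1] mf f0 f1.
set h := fun x : MR => (c + r * (x - c))%R : MR.
pose J : set MR := `[h 0%R, h 1%R]%classic.
pose K : set MR := `[0%R, h 0%R[ `|` `]h 1%R, 1%R].
have h0 : (0 <= h 0)%R by rewrite /h sub0r mulrN subr_ge0 ler_piMl.
have h1 : (h 1 <= 1)%R by rewrite /h; nra.
have hr : (h 1 - h 0 = r)%R by rewrite /h; ring.
have mJ : measurable J by exact: measurable_itv.
have mK : measurable K by apply: measurableU; exact: measurable_itv.
have E : `[0%R, 1%R]%classic = J `|` K :> set MR.
  apply/seteqP; split => x; rewrite /J /K /= !in_itv /=.
    case/andP=> x0 x1; case: (ltP x (h 0%R)) => hx0.
      by right; left; rewrite x0.
    by case: (leP x (h 1%R)) => hx1; [left|right; right; rewrite x1].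
  by case=> [/andP[? ?]|[|] /andP[? ?]]; apply/andP; split; lra.
rewrite [leLHS](_ : _ =
    \int[mu]_(x in J) f x + \int[mu]_(x in K) f x); last first.
  rewrite E ge0_integral_setU //; first exact: measurable_funTS.
  apply/disj_setPS => x; rewrite /J /K /= !in_itv /=.
  by case=> /andP[? ?] [|] /andP[? ?]; lra.
apply: leeD.
  rewrite (ge0_integral_homothety c r0) //; last exact: measurable_funTS.
  rewrite -/h (_ : h @^-1` J = `[0%R, 1%R]%classic).
    rewrite -[leRHS]mul1e; apply: lee_wpmul2r; last by rewrite lee_fin.
    by apply: integral_ge0 => x _; exact: f0.
  apply/seteqP; split => x; rewrite /J /= !in_itv /= /h !lerD2l !ler_pM2l //;
    by rewrite !lerD2r.
apply: (@le_trans _ _ (\int[mu]_(x in K) cst 1 x)).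
  apply: ge0_le_integral => //; first exact: measurable_funTS.
  move=> x; rewrite /K /= !in_itv /= => Kx; apply: f1.
  by case: Kx => /andP[? ?]; apply/andP; split; lra.
rewrite integral_cst // mul1e.
rewrite [leLHS](_ : _ = mu `[0%R, h 0%R[ + mu `]h 1%R, 1%R]); last first.
  rewrite /K measureU //; apply/seteqP; split => x //=; rewrite !in_itv /=.
  by case=> /andP[? ?] /andP[? ?]; lra.
rewrite !lebesgue_measure_itv /= !lte_fin.
have -> : (1 - r = h 0 + (1 - h 1))%R by rewrite -hr; ring.
rewrite [leRHS]EFinD; apply: leeD; case: ifP => _;
  by rewrite ?oppr0 ?adde0 ?lee_fin ?subr_ge0.
Qed.

(** The preimage in the cube, not the image, of [A] under the contraction of ratio r towards x. *)
Definition contract n (x : 'rV[R]_n) (r : R) (A : set 'rV[R]_n)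
    : set 'rV[R]_n :=
  [set y | Q1 y /\ A (x + r *: (y - x))%R].

Lemma contract_slice n (a : R) (x : 'rV[R]_n) r (A : set 'rV[R]_n.+1) b :
  (0 <= b <= 1)%R ->
  slice (contract (row_mx a%:M x : 'rV[R]_(1 + n)) r A) b =
  contract x r (slice A (a + r * (b - a))).
Proof.
move=> b01.
have E y : (row_mx a%:M x + r *: (row_mx b%:M y - row_mx a%:M x) =
    row_mx (a + r * (b - a))%:M (x + r *: (y - x)) :> 'rV[R]_(1 + n))%R.
  apply/rowP => i; rewrite !mxE; case: splitP => j _; rewrite !mxE //.
  by rewrite ord1 eqxx !mulr1n.
apply/seteqP; split => y; rewrite /slice /contract /= E.
  by case=> /Q1_row[_ Qy].
by case=> Qy Ay; split => //; apply/Q1_row.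
Qed.

Lemma row_measurable_Q1 n : row_measurable (@Q1 R n).
Proof.
have m01 : measurable (`[0%R, 1%R]%classic : set MR).
  exact: measurable_itv.
rewrite /row_measurable (_ : [set t | _] = \bigcap_(i in [set: 'I_n])
      ((fun t : n.-tuple MR => tnth t i) @^-1` `[0%R, 1%R])).
  apply: fin_bigcap_measurable => [|i _]; first exact: finite_finset.
  rewrite -[X in measurable X]setTI.
  exact: (@measurable_tnth _ MR n i measurableT _ m01).
apply/seteqP; split => t /= Qt i.
  by move=> _; have := Qt i; rewrite mxE /= in_itv.
by have := Qt i I; rewrite /= in_itv mxE.
Qed.

Lemma measurable_contract n (x : 'rV[R]_n) r A :
  row_measurable A -> row_measurable (contract x r A).
Proof.
move=> mA; rewrite /row_measurable.
have mQ := @row_measurable_Q1 n.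
have mh : measurable_fun setT (fun t : n.-tuple MR =>
    [tuple (x 0 i + r * (tnth t i - x 0 i))%R : MR | i < n]).
  apply/measurable_fun_tnthP => i.
  rewrite (_ : _ \o _ = (fun s : MR => (x 0 i + r * (s - x 0 i))%R : MR)
      \o (fun t => tnth t i)); last first.
    by apply/funext => t /=; rewrite tnth_mktuple.
  apply: measurableT_comp; first exact: measurable_homothety.
  exact: measurable_tnth.
have := mh measurableT _ mA; rewrite setTI => mhA.
have := measurableI _ _ mQ mhA; congr measurable.
apply/seteqP; split => t /=; rewrite /contract /=.
  case=> Qt At; split => //; move: At; congr A.
  by apply/rowP => i; rewrite !mxE tnth_mktuple.
case=> Qt At; split => //; move: At; congr A.
by apply/rowP => i; rewrite !mxE tnth_mktuple.
Qed.

(* Changing one coordinate at a time costs 1 - r each. *)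
Lemma leb_contract n (x : 'rV[R]_n) r A : row_measurable A ->
  A `<=` @Q1 R n -> Q1 x -> (0 < r <= 1)%R ->
  leb A <= leb (contract x r A) + (n%:R * (1 - r))%:E.
Proof.
move=> + + + r01; elim: n x A => [|n IH] x A mA AQ Qx.
  rewrite mul0r adde0 /= !lee_fin !indicE ler_nat.
  have [A0|] := boolP (0%R \in A); last by case: (_ \in _).
  rewrite mem_set //; split; first by case.
  move: A0; rewrite inE; congr A; apply/rowP; by case.
have [a [x' Ex]] : exists a x', x = (row_mx a%:M x' : 'rV[R]_(1 + n)).
  exists ((lsubmx (x : 'rV[R]_(1 + n))) 0%R 0%R), (rsubmx (x : 'rV[R]_(1 + n))).
  by rewrite -mx11_scalar hsubmxK.
move: Qx; rewrite Ex => /Q1_row[a01 Qx'].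
have CQ : contract (row_mx a%:M x' : 'rV[R]_(1 + n)) r A `<=` @Q1 R n.+1.
  by move=> y [].
have mC : row_measurable (contract (row_mx a%:M x' : 'rV[R]_(1 + n)) r A).
  exact: measurable_contract.
have ms := measurable_leb_slice mA; have mCs := measurable_leb_slice mC.
have mh := measurable_homothety a r.
have msh : measurable_fun setT
    (fun b : MR => leb (slice A (a + r * (b - a))%R)).
  exact: (measurableT_comp ms mh).
rewrite !lebS //.
apply: le_trans (integral_homothety_le a01 r01 ms _ _) _.
- by move=> b; exact: leb_ge0.
- by move=> b _; apply: leb_le1; [exact: measurable_slice|exact: slice_Q1].
have -> : (n.+1%:R * (1 - r))%:E = (n%:R * (1 - r))%:E + (1 - r)%:E.
  by rewrite -[RHS]EFinD -natr1 mulrDl mul1r.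
rewrite addeA; apply: leeD; last exact: lexx.
have r1 : (0 <= n%:R * (1 - r))%R.
  by rewrite mulr_ge0 // subr_ge0; case/andP: r01.
rewrite -[X in _ <= _ + X]mule1 -[X in _ <= _ + _ * X](lebesgue_measure01 R).
rewrite -integral_cst // -ge0_integralD //; last 2 first.
- by move=> b _; exact: leb_ge0.
- exact: measurable_funTS.
apply: ge0_le_integral => //.
- by move=> b _; exact: leb_ge0.
- exact: measurable_funTS.
- by apply: emeasurable_funD => //; exact: measurable_funTS.
move=> b; rewrite /= in_itv /= => b01; rewrite contract_slice //.
by apply: IH => //; [exact: measurable_slice|exact: slice_Q1].
Qed.

End Homothety.

(** * Points of a segment lying in a set of given measure *)

Section Pigeonhole.
Variable R : realType.
Local Notation mu := (@lebesgue_measure R).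

(** Induction on the dimension: if the slices at every a had total measure at most s, so would the
    integral over [0, 1]. In dimension 0 the measure is the indicator itself. *)
Lemma leb_pigeonhole (I : finType) n (A : I -> set 'rV[R]_n) (s : R) :
  (forall i, row_measurable (A i)) -> (forall i, A i `<=` @Q1 R n) ->
  (s%:E < \sum_i leb (A i))%E ->
  exists y, Q1 y /\ s < \sum_i \1_(A i) y.
Proof.
elim: n A => [|n IH] A mA AQ.
  by rewrite /= sumEFin lte_fin => sA; exists 0; split => // -[].
under eq_bigr => i _ do rewrite lebS //.
rewrite -ge0_integral_sum //; last 2 first.
- by move=> i; apply: measurable_funTS; exact: measurable_leb_slice.
- by move=> i a _; exact: leb_ge0.
move=> sA.
have [a [a01 sa]] : exists a, 0 <= a <= 1 /\
    (s%:E < \sum_i leb (slice (A i) a))%E.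
  apply: contrapT => Na; move: sA; rewrite ltNge => /negP; apply.
  rewrite -[leRHS]mule1 -[X in (_ <= _ * X)%E](lebesgue_measure01 R).
  rewrite -integral_cst //; apply: ge0_le_integral => //.
  - by move=> a _; apply: sume_ge0 => i _; exact: leb_ge0.
  - apply: emeasurable_sum => i; apply: measurable_funTS.
    exact: measurable_leb_slice.
  - move=> a; rewrite /= in_itv /= => a01; rewrite leNgt; apply/negP => sa.
    by apply: Na; exists a.
have [|||y [Qy sy]] := IH (fun i => slice (A i) a).
- by move=> i; exact: measurable_slice.
- by move=> i; exact: slice_Q1.
- exact: sa.
exists (row_mx a%:M y : 'rV[R]_(1 + n)); split; first exact/Q1_row.
exact: sy.
Qed.

Lemma sorted_ltn_nth_sub (s : seq nat) (i j : nat) : sorted ltn s ->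
  (i <= j)%N -> (j < size s)%N -> (nth 0 s i + (j - i) <= nth 0 s j)%N.
Proof.
move=> ss; elim: j => [|j IH]; first by rewrite leqn0 => /eqP ->; rewrite addn0.
rewrite leq_eqVlt => /orP[/eqP -> |]; first by rewrite subnn addn0.
rewrite ltnS => ij js; have := IH ij (ltnW js).
have : (nth 0 s j < nth 0 s j.+1)%N.
  by apply: (sorted_ltn_nth ltn_trans 0%N ss) => //; rewrite inE // ltnW.
by rewrite subSn // addnS => jj le; exact: leq_ltn_trans le jj.
Qed.

(** Listed in increasing order, the i-th and j-th indices satisfying P are at least |i - j| apart,
    being distinct integers. *)
Lemma spread_indices M N (P : pred 'I_M) : (N <= \sum_i P i)%N ->
  exists f : 'I_N -> 'I_M, (forall j, P (f j)) /\
    forall i j : 'I_N, `|i%:R - j%:R : R| <= `|(f i)%:R - (f j)%:R|.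
Proof.
move=> NP.
have szP : (N <= size ([seq i <- enum 'I_M | P i]))%N.
  rewrite size_filter (leq_trans NP) // -sum1_count big_enum_cond.
  by rewrite [leqRHS]big_mkcond.
case: N NP szP => [|N] NP szP.
  by have f : 'I_0 -> 'I_M; [case|exists f; split => -[]].
pose s := [seq i <- enum 'I_M | P i].
have [x0 _] : exists x0, x0 \in s.
  have : (0 < size s)%N by exact: leq_trans szP.
  by case: (s) => // x t _; exists x; exact: mem_head.
pose f (j : 'I_N.+1) := nth x0 s j.
have js (j : 'I_N.+1) : (j < size s)%N by exact: leq_trans (ltn_ord j) szP.
exists f; split=> [j|].
  by have := mem_nth x0 (js j); rewrite mem_filter => /andP[].
have sv : sorted ltn (map val s).
  apply: (subseq_sorted ltn_trans (map_subseq val (filter_subseq P _))).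
  by rewrite val_enum_ord iota_ltn_sorted.
move=> i j; wlog ij : i j / (i <= j)%N => [H|].
  have [/H //|/ltnW/H] := leqP i j.
  by rewrite [X in _ -> X <= _]distrC [X in _ -> _ <= X]distrC.
have := @sorted_ltn_nth_sub _ i j sv ij; rewrite size_map => /(_ (js j)).
rewrite !(nth_map x0) // -/(f i) -/(f j) => H.
rewrite distrC [leRHS]distrC -natrB // ger0_norm //.
apply: le_trans (ler_norm _); rewrite lerBrDr -natrD ler_nat.
by rewrite addnC.
Qed.

(** The M preimages of A under the contractions have measure at least d / 2 each. Their total
    exceeds N, so some y lies in N of them, that is, N of the points x + r (y - x) lie in A. *)
Lemma segment_hits n (A : set 'rV[R]_n) (x : 'rV[R]_n) (d : R) N :
  row_measurable A -> A `<=` @Q1 R n -> Q1 x -> (0 < n)%N -> (0 < N)%N ->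
  0 < d <= 1 -> (d%:E <= leb A)%E ->
  exists (y : 'rV[R]_n) (M : nat) (f : 'I_N -> 'I_M),
    let r (i : 'I_M) := 1 - d / (2 * n%:R) * (i%:R / M%:R) in
    [/\ Q1 y, 0 < (M%:R : R) <= 3 * N%:R / d,
        forall j, 0 <= r (f j) <= 1 /\ A (x + r (f j) *: (y - x)) &
        forall i j : 'I_N, `|i%:R - j%:R : R| <= `|(f i)%:R - (f j)%:R|].
Proof.
move=> mA AQ Qx n0 N0 /andP[d0 d1] dA.
have n1 : 1 <= n%:R :> R by rewrite ler1n.
have N1 : 1 <= N%:R :> R by rewrite ler1n.
(* M > 2 N / d, so that M preimages of measure d / 2 total more than N; rounding adds at most 1 <= N
   / d, whence M <= 3 N / d. *)
pose M := (Num.truncn (2 * N%:R / d)).+1.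
have X0 : 0 <= 2 * N%:R / d by rewrite divr_ge0 ?mulr_ge0 // ltW.
have M1 : 2 * N%:R / d < M%:R by rewrite truncnS_gt.
have M2 : M%:R <= 3 * N%:R / d.
  have -> : 3 * N%:R / d = 2 * N%:R / d + N%:R / d by field; rewrite gt_eqF.
  rewrite /M -natr1 lerD ?truncn_le // ler_pdivlMr // mul1r (le_trans d1) //.
have M0 : 0 < M%:R :> R by rewrite ltr0n.
pose r (i : 'I_M) := 1 - d / (2 * n%:R) * (i%:R / M%:R).
have iM (i : 'I_M) : 0 <= (i%:R / M%:R : R) <= 1.
  by rewrite divr_ge0 ?(ltW M0) //= ler_pdivrMr // mul1r ler_nat ltnW.
have dn : 0 < d / (2 * n%:R) <= 1 / 2.
  rewrite divr_gt0 ?mulr_gt0 ?(lt_le_trans _ n1) //=.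
  rewrite ler_pdivrMr ?mulr_gt0 ?(lt_le_trans _ n1) //; lra.
have r01 i : 0 < r i <= 1.
  have /andP[i0 i1] := iM i; have /andP[e0 e1] := dn; rewrite /r.
  apply/andP; split; last by rewrite gerBl mulr_ge0 // ltW.
  rewrite subr_gt0 (@le_lt_trans _ _ (1 / 2)) //; last by lra.
  by apply: le_trans e1; rewrite ler_piMr // ltW.
(* By [leb_contract], this is a loss of at most half of the measure d. *)
have rn i : n%:R * (1 - r i) <= d / 2.
  have -> : n%:R * (1 - r i) = d / 2 * (i%:R / M%:R).
    rewrite /r; field; rewrite (gt_eqF M0) /= gt_eqF // (lt_le_trans _ n1) //.
  by have /andP[_ i1] := iM i; rewrite ler_piMr // divr_ge0 // ltW.
(* The threshold is N - 1: an integer count above it is at least N. *)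
have [||| y [Qy hit]] :=
    @leb_pigeonhole _ n (fun i => contract x (r i) A) (N%:R - 1).
- by move=> i; exact: measurable_contract.
- by move=> i y [].
- have H i : ((d / 2)%:E <= leb (contract x (r i) A))%E.
    have := le_trans dA (leb_contract mA AQ Qx (r01 i)).
    rewrite -leeBlDr //; apply: le_trans.
    by rewrite -EFinB lee_fin; have := rn i; lra.
  apply: (@lt_le_trans _ _ (\sum_(i < M) (d / 2)%:E)%E); last first.
    by apply: lee_sum => i _; exact: H.
  rewrite sumEFin lte_fin sumr_const card_ord -mulr_natr.
  have : 2 * N%:R < M%:R * d by rewrite -ltr_pdivrMr.
  lra.
have [f [fP fd]] : exists f : 'I_N -> 'I_M,
    (forall j, `[< contract x (r (f j)) A y >]) /\
    forall i j : 'I_N, `|i%:R - j%:R : R| <= `|(f i)%:R - (f j)%:R|.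
  apply: (@spread_indices M N (fun i => `[< contract x (r i) A y >])).
  rewrite -ltnS -(ltr_nat R) -[X in _ < X]natr1 natr_sum -ltrBlDr.
  apply: lt_le_trans hit _; apply: ler_sum => i _.
  by rewrite indicE ler_nat; apply/eq_leq; congr nat_of_bool;
    apply/idP/asboolP; rewrite inE.
exists y, M, f => r'; split => //; first by rewrite M0.
move=> j; split; first by have /andP[/ltW -> ->] := r01 (f j).
by have /asboolP[] := fP j.
Qed.

End Pigeonhole.

(** * Measurability and boundedness of quasipolynomials *)

Section QuasipolyRegularity.
Variable R : realType.
Local Notation MR := (measurableTypeR R).

Section ComplexMeasurable.
Context d (T : measurableType d).
Implicit Types f g : T -> R[i].

Definition complex_measurable f :=
  measurable_fun setT (fun t => complex.Re (f t) : MR) /\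
  measurable_fun setT (fun t => complex.Im (f t) : MR).

Lemma complex_measurable_cst a : complex_measurable (fun=> a).
Proof. by split; exact: measurable_cst. Qed.

Lemma complex_measurableD f g : complex_measurable f -> complex_measurable g ->
  complex_measurable (fun t => f t + g t).
Proof.
move=> [fR fI] [gR gI]; split.
  rewrite (_ : (fun t => _) = (fun t => complex.Re (f t) + complex.Re (g t))).
    exact: measurable_funD.
  by apply/funext => t; case: (f t) (g t) => ? ? [].
rewrite (_ : (fun t => _) = (fun t => complex.Im (f t) + complex.Im (g t))).
  exact: measurable_funD.
by apply/funext => t; case: (f t) (g t) => ? ? [].
Qed.

Lemma complex_measurableM f g : complex_measurable f -> complex_measurable g ->
  complex_measurable (fun t => f t * g t).
Proof.
move=> [fR fI] [gR gI]; split.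
  rewrite (_ : (fun t => _) = (fun t => complex.Re (f t) * complex.Re (g t)
                                      - complex.Im (f t) * complex.Im (g t))).
    by apply: measurable_funB; exact: measurable_funM.
  by apply/funext => t; case: (f t) (g t) => ? ? [].
rewrite (_ : (fun t => _) = (fun t => complex.Re (f t) * complex.Im (g t)
                                    + complex.Im (f t) * complex.Re (g t))).
  by apply: measurable_funD; exact: measurable_funM.
by apply/funext => t; case: (f t) (g t) => ? ? [] * /=; ring.
Qed.

Lemma complex_measurable_sum (I : Type) (r : seq I) (f : I -> T -> R[i]) :
  (forall i, complex_measurable (f i)) ->
  complex_measurable (fun t => \sum_(i <- r) f i t).
Proof.
move=> mf; elim: r => [|i r IH].
  rewrite (_ : (fun t => _) = fun=> 0); first exact: complex_measurable_cst.
  by apply/funext => t; rewrite big_nil.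
rewrite (_ : (fun t => _) = fun t => f i t + \sum_(i <- r) f i t).
  exact: complex_measurableD.
by apply/funext => t; rewrite big_cons.
Qed.

Lemma complex_measurable_prod (I : Type) (r : seq I) (f : I -> T -> R[i]) :
  (forall i, complex_measurable (f i)) ->
  complex_measurable (fun t => \prod_(i <- r) f i t).
Proof.
move=> mf; elim: r => [|i r IH].
  rewrite (_ : (fun t => _) = fun=> 1); first exact: complex_measurable_cst.
  by apply/funext => t; rewrite big_nil.
rewrite (_ : (fun t => _) = fun t => f i t * \prod_(i <- r) f i t).
  exact: complex_measurableM.
by apply/funext => t; rewrite big_cons.
Qed.

Lemma complex_measurableX f e : complex_measurable f ->
  complex_measurable (fun t => f t ^+ e).
Proof.
move=> mf; rewrite (_ : (fun t => _) = fun t => \prod_(i <- iota 0 e) f t).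
  by apply: complex_measurable_prod.
apply/funext => t.
by rewrite big_const_seq count_predT size_iota iter_mulr mulr1.
Qed.

Lemma complex_measurable_cexp f : complex_measurable f ->
  complex_measurable (fun t => cexp (f t)).
Proof.
move=> [fR fI].
have mC : measurable_fun setT (fun t => cos (complex.Im (f t)) : MR).
  exact: (measurableT_comp (continuous_measurable_fun (@continuous_cos R)) fI).
have mS : measurable_fun setT (fun t => sin (complex.Im (f t)) : MR).
  exact: (measurableT_comp (continuous_measurable_fun (@continuous_sin R)) fI).
have mE : measurable_fun setT (fun t => expR (complex.Re (f t)) : MR).
  exact: (measurableT_comp (continuous_measurable_fun (@continuous_expR R)) fR).
by split; exact: measurable_funM.
Qed.

Lemma measurable_cmod_le f rho : complex_measurable f ->
  measurable [set t | cmod (f t) <= rho].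
Proof.
move=> [fR fI].
have mN : measurable_fun setT (fun t => complex.Re (f t) ^+ 2
                                      + complex.Im (f t) ^+ 2 : MR).
  by apply: measurable_funD; exact: measurable_funX.
have m0 : measurable_fun setT (fun t => cmod (f t) : MR).
  rewrite (_ : (fun t => _) = (@Num.sqrt R : MR -> MR) \o
    (fun t => complex.Re (f t) ^+ 2 + complex.Im (f t) ^+ 2)); last first.
    by apply/funext => t /=; rewrite /cmod; case: (f t).
  exact: (measurableT_comp (continuous_measurable_fun (@sqrt_continuous R)) mN).
rewrite (_ : [set t | _] =
    setT `&` (fun t => cmod (f t) : MR) @^-1` `]-oo, rho]).
  by apply: m0 => //; exact: measurable_itv.
by apply/seteqP; split => t /=; rewrite in_itv /=; [move=> ?|case].
Qed.

End ComplexMeasurable.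

Local Notation toC := (map_mx (fun r : R => r%:C%C)).

Lemma qp_eval_measurable n k (p : quasipoly R n k) :
  complex_measurable (fun t : n.-tuple MR => qp_eval p (toC (row_of_tuple t))).
Proof.
have mX i : complex_measurable
    (fun t : n.-tuple MR => toC (row_of_tuple t) 0 i).
  split.
    rewrite (_ : (fun t => _) = (fun t => tnth t i)).
      exact: measurable_tnth.
    by apply/funext => t; rewrite !mxE.
  rewrite (_ : (fun t => _) = (fun t => 0)); first exact: measurable_cst.
  by apply/funext => t; rewrite !mxE.
apply: complex_measurable_sum => j; apply: complex_measurableM.
  rewrite (_ : (fun t => _) = fun t : n.-tuple MR =>
      \sum_(e <- mpoly.msupp (qp_coef p j)) mpoly.mcoeff e (qp_coef p j) *
        \prod_i (toC (row_of_tuple t) 0 i) ^+ e i); last first.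
    by apply/funext => t; rewrite mpoly.mevalE.
  apply: complex_measurable_sum => e; apply: complex_measurableM.
    exact: complex_measurable_cst.
  by apply: complex_measurable_prod => i; exact: complex_measurableX.
apply: complex_measurable_cexp; apply: complex_measurable_sum => i.
by apply: complex_measurableM => //; exact: complex_measurable_cst.
Qed.

Lemma row_measurable_sublevel n k (p : quasipoly R n k) rho :
  row_measurable [set x | @Q1 R n x /\ qp_abs p x <= rho].
Proof.
have := measurableI _ _ (@row_measurable_Q1 R n)
  (measurable_cmod_le rho (qp_eval_measurable p)).
by congr measurable; apply/seteqP; split.
Qed.

(** This makes suprema over subsets of the cube genuine upper bounds. Functions bounded on the cube
    are closed under sums and products. *)
Lemma qp_abs_bounded n k (p : quasipoly R n k) :
  has_ubound [set qp_abs p x | x in @Q1 R n].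
Proof.
pose bd (f : 'rV[R]_n -> R[i]) := exists B, forall x, Q1 x -> cmod (f x) <= B.
have bc a : bd (fun=> a) by exists (cmod a).
have bM f g : bd f -> bd g -> bd (fun x => f x * g x).
  move=> [B fB] [C gC]; exists (B * C) => x Qx.
  by rewrite cmodM ler_pM ?cmod_ge0 ?fB ?gC.
have bS (I : Type) (r : seq I) (f : I -> 'rV[R]_n -> R[i]) :
    (forall i, bd (f i)) -> bd (fun x => \sum_(i <- r) f i x).
  move=> bf; elim: r => [|i r [B IH]].
    by exists 0 => x _; rewrite big_nil cmod0.
  have [C fC] := bf i; exists (C + B) => x Qx; rewrite big_cons.
  by rewrite (le_trans (cmodD _ _)) // lerD ?fC ?IH.
have x1 i x : Q1 x -> cmod (toC x 0 i) <= 1.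
  by move=> /(_ i) /andP[x0 x1]; rewrite mxE cmod_real ger0_norm.
suff [B pB] : bd (fun x => qp_eval p (toC x)).
  by exists B => _ [x Qx <-]; exact: pB.
apply: (bS) => j; apply: (bM).
  have [|B hB] := bS _ (mpoly.msupp (qp_coef p j)) (fun e x =>
      mpoly.mcoeff e (qp_coef p j) * \prod_i (toC x 0 i) ^+ e i).
    move=> e; apply: bM => //; exists 1 => x Qx; rewrite cmod_prod.
    apply: prodr_ile1 => i; rewrite cmodX exprn_ge0 ?cmod_ge0 //=.
    by rewrite exprn_ile1 ?cmod_ge0 // x1.
  by exists B => x Qx; rewrite mpoly.mevalE hB.
exists (expR (\sum_i cmod (qp_exp p j 0 i))) => x Qx.
rewrite cmod_cexp ler_expR (le_trans (ler_norm _)) //.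
rewrite (le_trans (Re_le_cmod _)) // (le_trans (cmod_sum _ _ _)) //.
by apply: ler_sum => i _; rewrite cmodM ler_piMr ?cmod_ge0 // x1.
Qed.

Lemma enorm_le_diam n (x y : 'rV[R]_n) : Q1 x -> Q1 y ->
  enorm (y - x) <= diam (@Q1 R n).
Proof.
move=> Qx Qy; apply: ub_le_sup; last by exists (y, x).
exists (Num.sqrt n%:R) => _ [[u v] /= [Qu Qv] <-].
rewrite ler_sqrt // (@le_trans _ _ (\sum_(i < n) 1)) //.
  apply: ler_sum => i _; rewrite !mxE.
  by move: (Qu i) (Qv i) => /andP[? ?] /andP[? ?]; nra.
by rewrite sumr_const card_ord.
Qed.

End QuasipolyRegularity.

(** * Metric span *)

Section MetricSpan.
Variable R : realType.

Lemma covered_Q1 n (e : R) : 0 < e -> exists N, covered e (@Q1 R n) N.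
Proof.
move=> e0.
pose G := (Num.truncn (1 / e)).+1.
pose J := {ffun 'I_n -> 'I_G}.
exists #|J|, (fun j => \row_i (e * (@enum_val J J j i)%:R)) => x Qx.
pose g : J := [ffun i => inord (Num.truncn (x 0 i / e))].
have gE i : g i = Num.truncn (x 0 i / e) :> nat.
  rewrite ffunE inordK // ltnS; apply: le_truncn.
  by rewrite ler_pM2r ?invr_gt0 //; case/andP: (Qx i).
exists (enum_rank g) => //.
exists (x - \row_i (e * (g i)%:R)); last by rewrite enum_rankK addrC subrK.
move=> i; rewrite !mxE gE; have /andP[x0 _] := Qx i.
have xe : 0 <= x 0 i / e by rewrite divr_ge0 // ltW.
have /andP[l u] := truncn_itv xe.
move: l u; rewrite ler_pdivlMr // ltr_pdivrMr // -natr1 mulrDl mul1r => l u.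
by rewrite mulrC; apply/andP; split; lra.
Qed.

Lemma coveredS n (e : R) (A B : set 'rV[R]_n) N :
  A `<=` B -> covered e B N -> covered e A N.
Proof. by move=> AB [t Bt]; exists t; exact: subset_trans Bt. Qed.

(** Subsets of the cube have finite covers by a grid, so [cover_num] is the true minimum and not a
    default value. *)
Lemma cover_numP n (e : R) (A : set 'rV[R]_n) : 0 < e -> A `<=` @Q1 R n ->
  covered e A (cover_num e A) /\
  forall N, covered e A N -> (cover_num e A <= N)%N.
Proof.
move=> e0 AQ; have [N0 cN0] := covered_Q1 n e0.
have ex : exists N, `[< covered e A N >].
  by exists N0; apply/asboolP; exact: coveredS cN0.
apply: (@xgetPex _ 0%N [set N | covered e A N /\
                         forall N', covered e A N' -> (N <= N')%N]).
have [N /asboolP cN minN] := ex_minnP ex; exists N; split => // N' cN'.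
exact/minN/asboolP.
Qed.

Lemma cover_num_le n (e : R) (A B : set 'rV[R]_n) : 0 < e -> A `<=` B ->
  B `<=` @Q1 R n -> (cover_num e A <= cover_num e B)%N.
Proof.
move=> e0 AB BQ; have [cB _] := cover_numP e0 BQ.
have [_] := cover_numP e0 (subset_trans AB BQ); apply.
exact: coveredS cB.
Qed.

Lemma le_qp_sup n k (p : quasipoly R n k) Omega x : Omega `<=` @Q1 R n ->
  Omega x -> qp_abs p x <= qp_sup p Omega.
Proof.
move=> OQ Ox; apply: ub_le_sup; last by exists x.
have [B pB] := qp_abs_bounded p; exists B => _ [y Oy <-].
by apply: pB; exists y => //; exact: OQ.
Qed.

Lemma qp_sup_ge0 n k (p : quasipoly R n k) Omega : Omega `<=` @Q1 R n ->
  0 <= qp_sup p Omega.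
Proof.
move=> OQ; have [->|/set0P[x Ox]] := eqVneq Omega set0.
  by rewrite /qp_sup image_set0 sup0.
by apply: le_trans (le_qp_sup p OQ Ox); exact: cmod_ge0.
Qed.

(** Omega lies in the sublevel set, so its covering number is at most that of the latter, to which
    the frequency bound applies; multiply by e^n and take the supremum over e. *)
Lemma metric_span_le_leb n k (p : quasipoly R n k) (C : 'I_n -> R) Omega :
  frequency_bound (qp_diagram p) C -> Omega `<=` @Q1 R n ->
  ((metric_span C Omega)%:E <=
   leb [set x | @Q1 R n x /\ (qp_abs p x <= qp_sup p Omega)%R])%E.
Proof.
move=> [_ fb] OQ; set A := [set x | _].
have AQ : A `<=` @Q1 R n by move=> x [].
have OA : Omega `<=` A by move=> x Ox; split; [exact: OQ|exact: le_qp_sup].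
have mA : row_measurable A by exact: row_measurable_sublevel.
have fA : leb A \is a fin_num.
  by rewrite ge0_fin_numE ?leb_ge0 // (le_lt_trans (leb_le1 mA AQ)) ?ltry.
rewrite -(fineK fA) lee_fin; apply: ge_sup => [|_ [e /= /andP[e0 e1] <-]].
  by exists (1 ^+ n * ((cover_num 1 Omega)%:R - span_poly C 1)), 1;
    rewrite //= ltr01 lexx.
have := fb p _ e erefl (qp_sup_ge0 p OQ); rewrite e0 e1 => /(_ isT) /=.
rewrite -/A -(fineK fA) -EFinM -EFinD lee_fin => H.
rewrite mulrC -ler_pdivlMr ?exprn_gt0 // lerBlDl (le_trans _ H) // ler_nat.
exact: cover_num_le.
Qed.

End MetricSpan.

(** * The Remez inequality in terms of the metric span *)

Theorem theorem4p2 (R : realType) :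
  exists (c c1 c2 : R) (cmk : nat -> nat -> R),
    [/\ 0 < c, 0 < c1, 0 < c2 & forall m k : nat, 0 < cmk m k] /\
    forall (n k : nat) (p : quasipoly R n k) (C : 'I_n -> R)
      (Omega : set 'rV[R]_n),
      (0 < n)%N -> (0 < k)%N ->
      frequency_bound (qp_diagram p) C ->
      Omega `<=` @Q1 R n ->
      0 < metric_span C Omega ->
      let B := @Q1 R n in
      let m := qp_degree p in
      let t := qp_type p in
      let ell := cmk m k + (m%:R - 1) * ln (c1 * Num.max 1 t)
                 + c2 * t * diam B in
      qp_sup p B <=
        (c * n%:R * fine (leb B) / metric_span C Omega) `^ ell
        * qp_sup p Omega.
Proof.
set e : R := expR 1.
have e0 : 0 < e by exact: expR_gt0.
have e2 : 2 <= e by have := expR_ge1Dx (1 : R); rewrite -/e; lra.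
have b0 m : 0 <= bernstein_const R m by exact: bernstein_const_ge0.
(* The exponent reached below is 2 (N + 1) with N + 1 <= 4 e (1 + t diam) + 2 [bernstein_const] + 2,
   which gives 8 e and the constant term; 24 e comes from the base 24 e n / d^2. *)
exists (24 * e), 1, (8 * e), (fun m _ => 8 * e + 4 * bernstein_const R m + 4).
split.
  split=> // [||m _]; [exact: mulr_gt0|exact: mulr_gt0|].
  by have := b0 m; lra.
move=> n k p C Omega n0 k0 fb OQ; set d := metric_span C Omega => d0.
lazy zeta; set B := @Q1 R n; set m := qp_degree p; set t := qp_type p.
set ell := (X in _ `^ X).
set rho := qp_sup p Omega.
pose A := [set x | @Q1 R n x /\ qp_abs p x <= rho].
have mA : row_measurable A by exact: row_measurable_sublevel.
have AQ : A `<=` B by move=> x [].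
have dA : (d%:E <= leb A)%E by exact: metric_span_le_leb.
have d1 : d <= 1 by rewrite -lee_fin (le_trans dA) // leb_le1.
have rho0 : 0 <= rho by exact: qp_sup_ge0.
have n1 : 1 <= n%:R :> R by rewrite ler1n.
rewrite leb_Q1 /= mulr1.
apply: ge_sup => [|_ [x Qx <-]].
  by exists (qp_abs p 0), 0 => // i; rewrite mxE lexx ler01.
pose T := t * diam B.
have t0 : 0 <= t by exact: qp_type_ge0.
have diam0 : 0 <= diam B.
  by apply: le_trans (enorm_le_diam Qx Qx); exact: enorm_ge0.
have T0 : 0 <= T by exact: mulr_ge0.
pose L := Num.max 1 T.
have L1 : 1 <= L by rewrite le_max lexx.
have L0 : 0 < L by exact: lt_le_trans L1.
have LT : L <= 1 + T by rewrite ge_max lerDl T0 lerDr ler01.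
(* The sum of the two lower bounds that [exp_poly_remez] demands of the number of nodes. *)
pose X := 4 * e * L + 2 * bernstein_const R m.
have X0 : 0 <= X by rewrite addr_ge0 ?mulr_ge0 // ltW.
pose N := (Num.truncn X).+1.
have XN : X <= N.+1%:R.
  by rewrite (le_trans (ltW (truncnS_gt X))) // ler_nat.
have NX : N.+1%:R <= X + 2.
  have : (Num.truncn X)%:R <= X by rewrite truncn_le.
  by rewrite -natr1 /N -natr1; lra.
have N0 : 0 < N.+1%:R :> R by rewrite ltr0n.
have [|y [M [f [Qy /andP[M0 M3] hit sep]]]] :=
    @segment_hits R n A x d N.+1 mA AQ Qx n0 (ltn0Sn N) _ dA.
  by rewrite d0.
pose r (i : 'I_M) : R := 1 - d / (2 * n%:R) * (i%:R / M%:R).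
(* With parameter in [0, L] and direction (y - x) / L, the frequencies have modulus at most t |y -
   x| / L <= 1. *)
pose v := L^-1 *: (y - x).
have [lam [P [sP lamP PE]]] := qp_line p x v.
have m0 : (0 < m)%N.
  by rewrite /m /qp_degree (bigD1 (Ordinal k0)) //= addSn.
(* The gap between consecutive ratios; it becomes L s in the rescaled parameter. *)
pose s := d / (2 * n%:R) / M%:R.
have s0 : 0 < s by rewrite !divr_gt0 ?mulr_gt0 // (lt_le_trans _ n1).
pose w := L * s.
have w0 : 0 < w by exact: mulr_gt0.
have lam1 j : cmod (lam j) <= 1.
  rewrite (le_trans (lamP j)) // enormZ ger0_norm ?invr_ge0 ?(ltW L0) //.
  rewrite mulrCA mulrC ler_pdivrMr // mul1r le_max; apply/orP; right.
  by rewrite ler_wpM2l // enorm_le_diam.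
have vE a : x + (L * a) *: v = x + a *: (y - x).
  by rewrite /v scalerA mulrAC divff ?mul1r // gt_eqF.
have remez := exp_poly_remez (y := fun j => L * r (f j)) (w := w)
    (rho := rho) sP lam1 m0 L1 (ltn0Sn _) _ _ w0.
have px : qp_abs p x = cmod (exp_poly lam P 0) by rewrite -PE scale0r addr0.
rewrite px; apply: le_trans (remez _ _ _ _ _ 0 _) _.
- by rewrite (le_trans _ XN) // lerDl mulr_ge0.
- by rewrite (le_trans _ XN) // lerDr !mulr_ge0 // ltW.
- move=> i j; rewrite -mulrBr normrM (gtr0_norm L0) /w -mulrA ler_pM2l //.
  have -> : r (f i) - r (f j) = s * ((f j)%:R - (f i)%:R).
    rewrite /r /s; field.
    by rewrite (gt_eqF M0) /= gt_eqF // (lt_le_trans _ n1).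
  rewrite normrM (gtr0_norm s0) ler_pM2l //.
  by rewrite distrC (le_trans (sep _ _)) // distrC.
- move=> j; have [/andP[r0 r1] _] := hit j.
  by rewrite mulr_ge0 ?(ltW L0) //= ler_piMr // ltW.
- by move=> j; rewrite -PE vE; have [_ []] := hit j.
- by rewrite lexx ltW.
rewrite ler_wpM2r //.
(* The gap s contributes one factor 1 / d, and M <= 3 (N + 1) / d the other. *)
have LN : L / (w * N.+1%:R) <= 6 * n%:R / d ^+ 2.
  have -> : L / (w * N.+1%:R) = M%:R * (2 * n%:R / (d * N.+1%:R)).
    rewrite /w /s; field.
    by rewrite !gt_eqF // (lt_le_trans _ n1).
  apply: (@le_trans _ _ (3 * N.+1%:R / d * (2 * n%:R / (d * N.+1%:R)))).
    by rewrite ler_wpM2r // divr_ge0 ?mulr_ge0 // ltW.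
  rewrite le_eqVlt; apply/orP; left; apply/eqP; field.
  by rewrite !gt_eqF.
pose b := 24 * e * n%:R / d.
have b1 : 1 <= b.
  rewrite /b ler_pdivlMr // mul1r (le_trans d1) //.
  by have := e2; nra.
have Y0 : 0 <= L / (w * N.+1%:R) by rewrite divr_ge0 ?mulr_ge0 // ltW.
move: LN Y0; rewrite -/e; set Y := L / _ => LN Y0.
have eY0 : 0 <= 2 * e * Y by rewrite mulr_ge0 // mulr_ge0 // ltW.
(* Since d <= 1 <= 24 e n, the base 24 e n / d^2 is at most b^2, whence the exponent 2 (N + 1); the
   leading factor 2 goes into the base. *)
have step1 : 2 * (2 * e * Y) ^+ N.+1 <= b ^+ (2 * N.+1).
  apply: (@le_trans _ _ ((2 * (2 * e * Y)) ^+ N.+1)).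
    rewrite [leRHS]exprMn; apply: ler_wpM2r; first exact: exprn_ge0.
    by rewrite exprS ler_peMr // exprn_ege1 // ler1n.
  rewrite exprM; apply: lerXn2r; rewrite ?nnegrE ?sqr_ge0 //.
    exact: mulr_ge0.
  apply: (@le_trans _ _ (2 * (2 * e * (6 * n%:R / d ^+ 2)))).
    by rewrite ler_wpM2l // ler_wpM2l // mulr_ge0 // ltW.
  have -> : 2 * (2 * e * (6 * n%:R / d ^+ 2)) = b * d^-1.
    by rewrite /b; field; rewrite gt_eqF.
  rewrite expr2 ler_wpM2l ?(le_trans ler01 b1) // /b.
  by rewrite ler_peMl ?invr_ge0 ?(ltW d0) //; have := e2; nra.
apply: (le_trans step1); rewrite -powR_mulrn ?(le_trans ler01 b1) //.
rewrite -/b; apply: ler_powR => //.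
(* As b >= 1, it suffices to compare exponents; m >= 1 and max(1, t) >= 1 make the logarithmic term
   nonnegative. *)
have ln0 : 0 <= (m%:R - 1) * ln (1 * Num.max 1 t).
  rewrite mulr_ge0 ?subr_ge0 ?ler1n // ln_ge0 // mul1r le_max lexx //.
rewrite /ell natrM -[8 * e * t * _]mulrA -/T -mulrA.
move: ln0; set l := _ * ln _ => ln0.
have eL : e * L <= e * (1 + T) by rewrite ler_wpM2l // ltW.
move: NX; rewrite /X -mulrA => NX.
apply: (@le_trans _ _ (2 * (4 * (e * (1 + T)) + 2 * bernstein_const R m + 2))).
  by rewrite ler_wpM2l // (le_trans NX) // !lerD2r ler_wpM2l.
rewrite -subr_ge0 (_ : _ - _ = l) //; ring.
Qed.
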